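(* Let $n\ge 1$ and $N\ge 0$ be integers and let $a_1,\dots,a_{n+1},b,z_1,\dots,z_n$ be nonzero complex numbers with $b=a_1\cdots a_{n+1}z_1\cdots z_n$. Then $$\sum_{\substack{y_1+\dots+y_n=N\\ y_1,\dots,y_n\geq 0}} \frac{\Delta(zq^y)}{\Delta(z)}\prod_{k=1}^n\frac{\prod_{j=1}^{n+1}(a_jz_k)_{y_k}} {(bz_k)_{y_k}\prod_{j=1}^n(qz_k/z_j)_{y_k}}=\frac{(b/a_1,\dots,b/a_{n+1})_N} {(q,bz_1,\dots,bz_n)_N},$$ the sum being over integers $y_1,\dots,y_n$.
   Context: Fix $p\in\mathbb C$ with $|p|<1$ and $q\in\mathbb C\setminus\{0\}$. For $x\neq 0$ put $\theta(x)=\prod_{j=0}^\infty(1-p^jx)(1-p^{j+1}/x)$ (so $\theta(x)=1-x$ when $p=0$). The elliptic Pochhammer symbol is $(a)_k=\theta(a)\theta(aq)\cdots\theta(aq^{k-1})$ for integers $k\ge 0$, with $(a)_0=1$, and $(a_1,\dots,a_r)_k=(a_1)_k\cdots(a_r)_k$. For $z=(z_1,\dots,z_n)$, the elliptic Vandermonde determinant is $\Delta(z)=\prod_{1\le j<k\le n}z_j\,\theta(z_k/z_j)$, and $zq^y=(z_1q^{y_1},\dots,z_nq^{y_n})$. Standing assumption: all expressions are well-defined, i.e. the parameters are such that no denominator occurring on either side vanishes. *)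

(* Defs.v *)
From HB Require Import structures.
From mathcomp Require Import all_boot all_order all_algebra.
From mathcomp Require Import complex.
From mathcomp Require Import all_classical all_reals all_analysis.

Set Implicit Arguments.
Unset Strict Implicit.
Unset Printing Implicit Defensive.

Import Order.TTheory GRing.Theory Num.Theory.
Import numFieldNormedType.Exports.

Local Open Scope classical_set_scope.
Local Open Scope ring_scope.

(* The field K carries its norm topology; it is meant to be R[i], with R a
   realType. *)
Section EllipticPochhammer.
Variables (K : numFieldType) (p q : K).

(* \prod_(j >= 0) (1 - p ^ j x) (1 - p ^ (j + 1) / x), as the limit of the
   partial products; it converges when `|p| < 1. Since 0 ^+ 0 = 1, it is 1 - x
   when p = 0. *)
Definition theta (x : K) : K :=
  lim ((fun m : nat =>
    \prod_(0 <= j < m) ((1 - p ^+ j * x) * (1 - p ^+ j.+1 / x))) @ \oo).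

Definition epoch (a : K) (k : nat) : K := \prod_(0 <= i < k) theta (a * q ^+ i).

Definition evdm (n : nat) (z : 'I_n -> K) : K :=
  \prod_(j < n) \prod_(k < n | (j < k)%N) (z j * theta (z k / z j)).

Definition qshift (n : nat) (z : 'I_n -> K) (y : 'I_n -> nat) : 'I_n -> K :=
  fun k => z k * q ^+ y k.

End EllipticPochhammer.

(* Main.v *)
(* By Jacobi's triple product, theta (x y) theta (x / y) is a double series in
   which the variables x and y separate once the terms are split according to a
   parity; so theta (x y) theta (x / y) / x is a 2 x 2 determinant
   f(x) g(y) - g(x) f(y), and the Plücker relation gives Weierstrass's three-term
   identity for theta.  By induction on the number of nodes this yields an
   elliptic partial fraction expansion, which is equivalent to the case N = 1 of
   the summation.  The case N + 1 follows from the case N by using the expansion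
   twice: with nodes z q^y it distributes the terms of the sum with |y| = N + 1
   over the n predecessors y - e_k, and with nodes z q^x it evaluates the sum over
   k of the terms attached to x + e_k. *)

Require Import Defs.
From HB Require Import structures.
From mathcomp Require Import all_boot all_order all_algebra.
From mathcomp Require Import complex.
From mathcomp Require Import all_classical all_reals all_analysis.
From mathcomp Require Import ring lra zify.

Set Implicit Arguments.
Unset Strict Implicit.
Unset Printing Implicit Defensive.

Import Order.TTheory GRing.Theory Num.Theory.
Import numFieldNormedType.Exports.

Local Open Scope ring_scope.
Local Open Scope complex_scope.

(** * Partial fractions from the three-term identity *)

(** The algebra uses four properties of theta, stated for an abstract [th]: its value at 1,
    inversion, Weierstrass's identity, and the fact that a quotient of two zeros is a zero. The last
    one lets the induction on nodes treat all nodes with nonzero [th (v k / v j)] at once, so that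
    no generic position, continuity or Liouville argument occurs. The variables separate because the
    summation indices k, l are written as a + b + 1, a - b + 1 or as a + b + 1, a - b: then k (k -
    1) + l (l - 1) has no mixed term in a and b. The Plücker relation holds exactly for truncated
    determinants, and a limit is taken only in the resulting identity. What remains for analysis is
    the convergence of the truncated determinants to a product of two thetas; the obstacle is that
    the triple product and the parity splitting exhaust the lattice of pairs k, l by different
    finite sets. *)

Section PartialFractions.
Variables (F : fieldType) (th : F -> F).
Hypothesis th1 : th 1 = 0.
Hypothesis thV : forall x : F, x != 0 -> th x^-1 = - (x^-1 * th x).
(* Weierstrass's identity, written with a product [P] instead of the customary
   arguments [x y] and [x / y] so that no square root occurs. *)
Hypothesis th3 : forall P X a b c : F,
  P != 0 -> X != 0 -> a != 0 -> b != 0 -> c != 0 ->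
  th (b * c / P) * th (b / c) / b * (th (a * X) * th (P * X / a)) +
  th (c * a / P) * th (c / a) / c * (th (b * X) * th (P * X / b)) +
  th (a * b / P) * th (a / b) / a * (th (c * X) * th (P * X / c)) = 0.
Hypothesis thdiv : forall x y : F, x != 0 -> y != 0 ->
  th x = 0 -> th y = 0 -> th (x / y) = 0.

Lemma thV_eq0 x : x != 0 -> (th x^-1 == 0) = (th x == 0).
Proof. by move=> x0; rewrite thV// oppr_eq0 mulf_eq0 invr_eq0 (negPf x0). Qed.

(** Weierstrass's identity with [P = x * y], [X = u] and the points [x], [v^-1], [B]: since [B] is
    the product of all five variables, every argument collapses to a displayed one, up to
    inversion. *)
Lemma partial_fractions2 (x y w u v : F) :
  x != 0 -> y != 0 -> w != 0 -> u != 0 -> v != 0 -> th (u / v) != 0 ->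
  let B := x * y * w * u * v in
  th (x * u) * th (y * u) * th (w * u) * (th (B * v) / th (u / v)) +
  th (x * v) * th (y * v) * th (w * v) * (th (B * u) / th (v / u)) =
  th (B / x) * th (B / y) * th (B / w).
Proof.
move=> x0 y0 w0 u0 v0 uv0 B.
have B0 : B != 0 by rewrite !mulf_neq0.
have P0 : x * y != 0 by rewrite mulf_neq0.
have v'0 : v^-1 != 0 by rewrite invr_eq0.
have := th3 P0 u0 x0 v'0 B0.
have -> : v^-1 * B / (x * y) = w * u by rewrite /B; field; rewrite ?x0 ?y0 ?v0.
have -> : v^-1 / B = (B * v)^-1 by rewrite mulrC -invfM.
have -> : x * y * u / x = y * u by field.
have -> : B * x / (x * y) = B / y by field; rewrite ?x0 ?y0.
have -> : v^-1 * u = u / v by rewrite mulrC.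
have -> : x * y * u / v^-1 = B / w by rewrite invrK /B; field; rewrite ?w0 ?v0.
have -> : x / v / (x * y) = (y * v)^-1 by field; rewrite ?x0 ?y0 ?v0.
have -> : x / v^-1 = x * v by rewrite invrK.
have -> : x * y * u / B = (w * v)^-1 by rewrite /B; field; rewrite ?x0 ?y0 ?w0 ?u0 ?v0.
rewrite -[v / u]invf_div.
rewrite !thV ?mulf_neq0 ?invr_eq0// invrK invf_div.
move: (th (w * u)) (th (B * v)) (th (x * u)) (th (y * u)) (th (u / v)) uv0
  (th (B / x)) (th (B / y)) (th (B / w))
  (th (x * v)) (th (y * v)) (th (w * v)) (th (B * u)) =>
  t1 t2 t3 t4 t5 t50 t6 t7 t8 t9 t10 t11 t12 H.
apply/eqP; rewrite -subr_eq0.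
(* The difference of the two sides is [- B / th (u / v)] times the three-term expression. *)
have -> : t3 * t4 * t1 * (t2 / t5) + t9 * t10 * t11 * (t12 / - (v / u * t5)) - t6 * t7 * t8
   = - B / t5 * (t1 * - ((B * v)^-1 * t2) * v * (t3 * t4) + t7 * t6 / B * (t5 * t8) +
     - ((y * v)^-1 * t10) * t9 / x * (t12 * - ((w * v)^-1 * t11))).
  by rewrite /B; field; rewrite oppr_eq0 mulf_eq0 negb_or x0 y0 w0 u0 v0 t50.
by rewrite H mulr0.
Qed.

(* With [P] fixed, the difference [E x] of the two sides is a linear combination
   of functions [th (x X) th (P X / x)], which span a space of dimension two: it
   vanishes identically when it vanishes at two independent points. *)
Lemma partial_fractions_step (I : finType) (S : {set I}) (v : I -> F)
    (a : seq F) (P x : F) (k1 k2 : I) :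
  let B := P * \prod_(y <- a) y * \prod_(k in S) v k in
  let E x := \sum_(k in S) th (x * v k) * th (P * v k / x) *
      ((\prod_(y <- a) th (y * v k)) *
       \prod_(j in S :\ k) (th (B * v j) / th (v k / v j))) -
    th (B / x) * th (B * x / P) * \prod_(y <- a) th (B / y) in
  P != 0 -> x != 0 -> B != 0 -> (forall k, k \in S -> v k != 0) ->
  k1 \in S -> k2 \in S ->
  th (v k1 / v k2) != 0 -> th (P * v k1 * v k2) != 0 ->
  E (v k1)^-1 = 0 -> E (v k2)^-1 = 0 -> E x = 0.
Proof.
move=> B E P0 x0 B0 v0 Sk1 Sk2 h12 hP E1 E2.
have v10 := v0 _ Sk1; have v20 := v0 _ Sk2.
pose b := (v k1)^-1; pose c := (v k2)^-1.
have b0 : b != 0 by rewrite invr_eq0.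
have c0 : c != 0 by rewrite invr_eq0.
(* These are the coefficients, free of [X], of Weierstrass's linear relation between [f x], [f b]
   and [f c]. *)
pose al := th (b * c / P) * th (b / c) / b.
pose be := th (c * x / P) * th (c / x) / c.
pose ga := th (x * b / P) * th (x / b) / x.
pose f y X := th (y * X) * th (P * X / y).
pose g k := \prod_(y <- a) th (y * v k) *
  \prod_(j in S :\ k) (th (B * v j) / th (v k / v j)).
pose d := \prod_(y <- a) th (B / y).
have fE X : X != 0 -> al * f x X + be * f b X + ga * f c X = 0.
  by move=> X0; rewrite /al /be /ga /f th3.
(* The right-hand side of the expansion is one more value of [f y], at [X = B / P], so [E] inherits
   the relation. *)
have EE y : y != 0 -> E y = \sum_(k in S) f y (v k) * g k - f y (B / P) * d.
  move=> y0; congr (_ - _ * d); rewrite mulrC /f.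
  by congr (th _ * th _); field; rewrite ?P0 ?y0.
have sum_lin (p1 p2 p3 : F) (f1 f2 f3 h : I -> F) :
    p1 * (\sum_(k in S) f1 k * h k) + p2 * (\sum_(k in S) f2 k * h k) +
    p3 * (\sum_(k in S) f3 k * h k) =
    \sum_(k in S) (p1 * f1 k + p2 * f2 k + p3 * f3 k) * h k.
  rewrite !mulr_sumr -!big_split /=; apply: eq_bigr => k _; ring.
have : al * E x + be * E b + ga * E c = 0.
  transitivity (\sum_(k in S) (al * f x (v k) + be * f b (v k) + ga * f c (v k)) * g k -
    (al * f x (B / P) + be * f b (B / P) + ga * f c (B / P)) * d).
    rewrite !EE// -sum_lin; ring.
  have BP0 : B / P != 0 by rewrite mulf_neq0 ?invr_eq0.
  rewrite (fE _ BP0) mul0r subr0 big1// => k Sk.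
  by rewrite fE ?v0// mul0r.
rewrite E1 E2 !mulr0 !addr0 => /eqP; rewrite mulf_eq0 => /orP[|/eqP//].
(* Up to inversion the theta factors of [al] are [th (P * v k1 * v k2)] and [th (v k1 / v k2)]: the
   two nonvanishing hypotheses express the independence of the points [b] and [c]. *)
rewrite /al !mulf_eq0 -orbA => /or3P[].
- have -> : b * c / P = (P * v k1 * v k2)^-1 by rewrite /b /c; field; rewrite v10 v20 ?P0.
  by rewrite thV_eq0 ?mulf_neq0// (negPf hP).
- have -> : b / c = (v k1 / v k2)^-1 by rewrite /b /c; rewrite invf_div invrK mulrC.
  by rewrite thV_eq0 ?mulf_neq0 ?invr_eq0// (negPf h12).
- by rewrite invr_eq0 (negPf b0).
Qed.

(** This is the classical vanishing sum over the nodes [v k] and the extra node 1 / B, multiplied by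
    all [th (B * v j)]; in this form [th (B * v j)] may vanish. The induction merges two parameters
    [x], [y] into one while removing a node. *)
Lemma partial_fractions (I : finType) (S : {set I}) (v : I -> F) (a : seq F) :
  size a = #|S|.+1 -> (forall x, x \in a -> x != 0) ->
  (forall k, k \in S -> v k != 0) ->
  (forall j k, j \in S -> k \in S -> j != k -> th (v k / v j) != 0) ->
  let B := \prod_(x <- a) x * \prod_(k in S) v k in
  \sum_(k in S) (\prod_(x <- a) th (x * v k)) *
     \prod_(j in S :\ k) (th (B * v j) / th (v k / v j)) =
  \prod_(x <- a) th (B / x).
Proof.
move Dm : #|S| => m; elim: m S Dm a => [|m IHm] S Dm a sza a0 v0 hv /=.
  have S0 : S = finset.set0 by apply/eqP; rewrite -cards_eq0 Dm.
  case: a sza a0 => [|x []] //= _ a0.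
  rewrite S0 !big_set0 !big_seq1 mulr1 divff ?th1//.
  by apply: a0; rewrite inE.
case: m IHm Dm sza => [_ Dm|m IHm Dm].
  have /cards1P[k Sk] : #|S| == 1%N by rewrite Dm.
  case: a a0 => [|x [|y []]] //= a0 _.
  have x0 : x != 0 by rewrite a0 ?inE ?eqxx.
  have y0 : y != 0 by rewrite a0 ?inE ?eqxx ?orbT.
  have k0 : v k != 0 by rewrite v0// Sk finset.set11.
  rewrite Sk !big_set1 !big_cons !big_nil /= finset.setDv big_set0 !mulr1 mulrC.
  by congr (th _ * th _); field; rewrite ?x0 ?y0.
case: m IHm Dm => [_ Dm|m IHm Dm].
  have /cards2P[k1 [k2 [k12 Sk]]] : #|S| == 2%N by rewrite Dm.
  case: a a0 => [|x [|y [|w []]]] //= a0 _.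
  have x0 : x != 0 by rewrite a0 ?inE ?eqxx.
  have y0 : y != 0 by rewrite a0 ?inE ?eqxx ?orbT.
  have w0 : w != 0 by rewrite a0 ?inE ?eqxx ?orbT.
  have Sk1 : k1 \in S by rewrite Sk !inE eqxx.
  have Sk2 : k2 \in S by rewrite Sk !inE eqxx orbT.
  have D1 : S :\ k1 = [set k2].
    apply/setP=> j; rewrite Sk !inE; have [->|] := eqVneq j k1 => //=.
    by rewrite (negPf k12).
  have D2 : S :\ k2 = [set k1].
    apply/setP=> j; rewrite Sk !inE; have [->|] := eqVneq j k2 => //=.
    by rewrite eq_sym (negPf k12).
    by rewrite orbF.
  set B := (\prod_(z <- _) _ * _).
  have BE : B = x * y * w * v k1 * v k2.
    by rewrite /B (big_setD1 k1)//= D1 big_set1 !big_cons big_nil mulr1 !mulrA.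
  rewrite (big_setD1 k1)//= !D1 !big_set1 D2 big_set1.
  rewrite !big_cons !big_nil /= !mulr1 BE.
  have h : th (v k1 / v k2) != 0 by rewrite hv// eq_sym.
  have := partial_fractions2 x0 y0 w0 (v0 _ Sk1) (v0 _ Sk2) h.
  by rewrite /= !mulrA.
case: a a0 => [|x [|y a]] //= a0 [sza].
have x0 : x != 0 by rewrite a0 ?inE ?eqxx.
have y0 : y != 0 by rewrite a0 ?inE ?eqxx ?orbT.
have a'0 w : w \in a -> w != 0 by move=> aw; rewrite a0 ?inE ?aw ?orbT.
pose P := x * y; have P0 : P != 0 by rewrite mulf_neq0.
set B := (\prod_(w <- _) _ * _).
have BE : B = P * \prod_(w <- a) w * \prod_(k in S) v k by rewrite /B !big_cons !mulrA.
have B0 : B != 0.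
  rewrite BE !mulf_neq0//; first by rewrite prodf_seq_neq0; apply/allP => w /a'0.
  by apply/prodf_neq0.
pose E x := \sum_(k in S) th (x * v k) * th (P * v k / x) *
      ((\prod_(y <- a) th (y * v k)) *
       \prod_(j in S :\ k) (th (B * v j) / th (v k / v j))) -
    th (B / x) * th (B * x / P) * \prod_(y <- a) th (B / y).
(* At this point the term of index [k] contains [th 1], and the other terms form the expansion on
   [S :\ k] with [x], [y] replaced by the single parameter [P * v k]; the value of [B] is
   unchanged. *)
have Ev k : k \in S -> E (v k)^-1 = 0.
  move=> Sk; have k0 := v0 _ Sk.
  rewrite /E (big_setD1 k)//= mulVf// th1 !mul0r add0r.
  have SkS j : j \in S :\ k -> j \in S by rewrite inE => /andP[].
  have Dk : #|S :\ k| = m.+2 by apply/eqP; rewrite -eqSS -Dm [X in _ == X](cardsD1 k) Sk.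
  have := IHm (S :\ k) Dk (P * v k :: a).
  have -> : \prod_(w <- P * v k :: a) w * \prod_(k0 in S :\ k) v k0 = B.
    by rewrite BE big_cons [in RHS](big_setD1 k)//=; ring.
  rewrite /= sza => /(_ erefl) H.
  have {}H : \sum_(j in S :\ k) (\prod_(x1 <- (P * v k :: a)) th (x1 * v j)) *
      \prod_(i in S :\ k :\ j) (th (B * v i) / th (v j / v i)) =
      \prod_(x1 <- (P * v k :: a)) th (B / x1).
    apply: H => [w|j /SkS/v0//|i j /SkS Si /SkS Sj]; last exact: hv.
    by rewrite inE => /orP[/eqP->|/a'0//]; rewrite mulf_neq0.
  rewrite invrK.
  have -> : B * (v k)^-1 / P = B / (P * v k) by field; rewrite ?P0 ?k0.
  rewrite -[X in _ - X]mulrA -(big_cons _ _ (P * v k) a xpredT (fun x => th (B / x))) -H mulr_sumr.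
  apply/eqP; rewrite subr_eq0; apply/eqP; apply: eq_bigr => j.
  rewrite !inE => /andP[jk Sj].
  have hjk : th (v j / v k) != 0 by rewrite hv// eq_sym.
  rewrite (big_setD1 k) ?inE ?Sk 1?eq_sym ?jk//= big_cons.
  have -> : S :\ j :\ k = S :\ k :\ j by apply/setP=> i; rewrite !inE andbCA.
  by rewrite [(v k)^-1 * _]mulrC [P * v j * v k]mulrAC; field.
suff Ex : E x = 0.
  move/eqP: Ex; rewrite /E subr_eq0 => /eqP Ex.
  rewrite !big_cons mulrA.
  transitivity (th (B / x) * th (B * x / P) * \prod_(j <- a) th (B / j)); last first.
    by congr (_ * th _ * _); rewrite /P; field; rewrite ?x0 ?y0.
  rewrite -Ex; apply: eq_bigr => k Sk; rewrite !big_cons.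
  have -> : P * v k / x = y * v k by rewrite /P; field.
  by rewrite !mulrA.
(* Three nodes guarantee a usable pair: if [P * v k1 * v k2] and [P * v k1 * v k3] were both zeros
   of [th], so would be their quotient [v k2 / v k3]. Hence sizes 0, 1 and 2 are treated
   separately. *)
have /card_gt2P[k1 [k2] [k3 [[S1 S2 S3] [n12 n23 n31]]]] : (2 < #|S|)%N by rewrite Dm.
have step k l : k \in S -> l \in S -> th (v k / v l) != 0 ->
    th (P * v k * v l) != 0 -> E x = 0.
  move=> Sk Sl hkl Pkl; have := @partial_fractions_step I S v a P x k l.
  by rewrite /= -BE; apply=> //; exact: Ev.
have [z12|z12] := eqVneq (th (P * v k1 * v k2)) 0; last first.
  by apply: (step _ _ S1 S2 _ z12); apply: hv => //; rewrite eq_sym.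
have [z13|z13] := eqVneq (th (P * v k1 * v k3)) 0; last first.
  by apply: (step _ _ S1 S3 _ z13); rewrite hv.
have v10 := v0 _ S1; have v20 := v0 _ S2; have v30 := v0 _ S3.
have := thdiv _ _ z12 z13; rewrite !mulf_neq0// => /(_ isT isT).
have -> : P * v k1 * v k2 / (P * v k1 * v k3) = v k2 / v k3.
  by rewrite -mulf_div divff ?mul1r// mulf_neq0.
by move=> h; have := hv k3 k2 S3 S2; rewrite h eq_sym n23 eqxx => /(_ isT).
Qed.

Lemma size_index_ord n : size (index_enum 'I_n) = n.
Proof. by rewrite -sum1_size sum1_card card_ord. Qed.

Lemma partial_fractions_ord n (v : 'I_n -> F) (a : seq F) (B : F) :
  size a = n.+1 -> (forall x, x \in a -> x != 0) -> (forall k, v k != 0) ->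
  (forall j k, j != k -> th (v k / v j) != 0) ->
  \prod_(x <- a) x * \prod_(k < n) v k = B ->
  \sum_(k < n) (\prod_(x <- a) th (x * v k)) *
     \prod_(j < n | j != k) (th (B * v j) / th (v k / v j)) =
  \prod_(x <- a) th (B / x).
Proof.
move=> sza a0 v0 hv BE.
have setTk k : [set: 'I_n] :\ k =i [pred j | j != k] by move=> j; rewrite !inE andbT.
have sumT (f : 'I_n -> F) : \sum_(k in [set: 'I_n]) f k = \sum_(k < n) f k.
  by apply: eq_bigl => k; rewrite inE.
have prodT (f : 'I_n -> F) : \prod_(k in [set: 'I_n]) f k = \prod_(k < n) f k.
  by apply: eq_bigl => k; rewrite inE.
have := @partial_fractions _ [set: 'I_n] v a.
rewrite /= cardsT card_ord sumT prodT BE => <- //; last by move=> j k _ _; exact: hv.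
by apply: eq_bigr => k _; congr (_ * _); apply: eq_bigl => j; rewrite setTk.
Qed.

(** * The recursion in N *)

Variable q : F.
Hypothesis q0 : q != 0.

(* [poch], [vdm] and [shift] are [epoch], [evdm] and [qshift] for an abstract
   function [th]. *)
Definition poch (x : F) (k : nat) := \prod_(0 <= i < k) th (x * q ^+ i).
Definition vdm (n : nat) (w : 'I_n -> F) :=
  \prod_(j < n) \prod_(k < n | (j < k)%N) (w j * th (w k / w j)).
Definition shift (n : nat) (z : 'I_n -> F) (y : 'I_n -> nat) (k : 'I_n) :=
  z k * q ^+ y k.

Lemma pochS x k : poch x k.+1 = poch x k * th (x * q ^+ k).
Proof. by rewrite /poch big_nat_recr. Qed.

Lemma poch_neq0P x k : reflect (forall i, (i < k)%N -> th (x * q ^+ i) != 0) (poch x k != 0).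
Proof.
rewrite /poch big_mkord; apply: (iffP (prodf_neq0 _ _)) => [h i ik|h i _]; last exact: h.
exact: (h (Ordinal ik)).
Qed.

(* The first factor does not involve [w k]: a change of [w k] only affects the
   second one. *)
Lemma vdm_isolate n (k : 'I_n) (w : 'I_n -> F) : (forall i, w i != 0) ->
  vdm w = (\prod_(j < n | j != k) (if (k < j)%N then - w j else w j) *
    \prod_(i < n | i != k) \prod_(j < n | j != k)
      (if (i < j)%N then w i * th (w j / w i) else 1)) *
    \prod_(j < n | j != k) th (w k / w j).
Proof.
move=> w0; pose h (i j : 'I_n) := if (i < j)%N then w i * th (w j / w i) else 1.
have -> : vdm w = \prod_(i < n) \prod_(j < n) h i j.
  by apply: eq_bigr => i _; rewrite big_mkcond.
rewrite (bigD1 k)//= (bigD1 k)//= {1}/h ltnn mul1r.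
under [X in _ * X]eq_bigr do rewrite (bigD1 k)//=.
rewrite big_split /= mulrA -big_split /= [RHS]mulrAC -[in RHS]big_split /=; congr (_ * _).
apply: eq_bigr => j jk; rewrite /h.
case: ltngtP => [kj|kj|/val_inj kj]; last by rewrite kj eqxx in jk.
  rewrite mulr1 -[w j / w k]invf_div thV ?mulf_neq0 ?invr_eq0// invf_div.
  by field.
by rewrite mul1r.
Qed.

Lemma vdm_change1 n (k : 'I_n) (w w' : 'I_n -> F) :
  (forall i, w i != 0) -> w' k != 0 -> (forall i, i != k -> w' i = w i) ->
  vdm w' * \prod_(j < n | j != k) th (w k / w j) =
  vdm w * \prod_(j < n | j != k) th (w' k / w j).
Proof.
move=> w0 w'k0 ww'; have w'0 i : w' i != 0.
  by have [->//|/ww'->] := eqVneq i k.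
rewrite (vdm_isolate k w0) (vdm_isolate k w'0) mulrAC; congr (_ * _ * _).
- congr (_ * _); first by apply: eq_bigr => j /ww' ->.
  by apply: eq_bigr => i /ww' ->; apply: eq_bigr => j /ww' ->.
- by apply: eq_bigr => j /ww' ->.
Qed.

Section Jackson.
Variables (n : nat) (a : 'I_n.+1 -> F) (b : F) (z : 'I_n -> F).
Hypotheses (a0 : forall j, a j != 0) (b0 : b != 0) (z0 : forall k, z k != 0).
Hypothesis balanced : b = (\prod_(j < n.+1) a j) * \prod_(k < n) z k.

Definition jackson_term (y : 'I_n -> nat) :=
  vdm (shift z y) / vdm z *
  \prod_(k < n) ((\prod_(j < n.+1) poch (a j * z k) (y k)) /
    (poch (b * z k) (y k) * \prod_(j < n) poch (q * z k / z j) (y k))).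

(* [M] bounds all sums |y| that occur, so that the exponents stay in one finite
   type during the induction. *)
Variable M : nat.
Hypothesis bz_neq0 : forall k i, (i < M)%N -> th (b * z k * q ^+ i) != 0.
Hypothesis qz_neq0 : forall k j i, (i < M)%N -> th (q * z k / z j * q ^+ i) != 0.
Hypothesis z_neq0 : forall k j, j != k -> th (z k / z j) != 0.

Lemma shift_neq0 y k : shift z y k != 0.
Proof. by rewrite mulf_neq0 ?expf_neq0. Qed.

(** If the exponents differ, the ratio of the node with the larger one to the other is q z_l / z_i
    times a power of q below M, which is a denominator factor; the inverse ratio follows by
    inversion. Equal exponents leave [z k / z j]. *)
Lemma shift_ratio_neq0 (y : 'I_n -> nat) j k : (forall i, (y i <= M)%N) ->
  j != k -> th (shift z y k / shift z y j) != 0.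
Proof.
have gt_neq0 (l i : 'I_n) : (forall i, (y i <= M)%N) -> (y i < y l)%N ->
    th (shift z y l / shift z y i) != 0.
  move=> yM il; have -> : shift z y l / shift z y i =
      q * z l / z i * q ^+ (y l - y i).-1.
    rewrite /shift -[in q ^+ y l](subnKC (ltnW il)) exprD.
    rewrite -[in LHS](prednK (n := y l - y i)) ?subn_gt0// exprS.
    by field; rewrite z0 expf_neq0.
  by apply: qz_neq0; rewrite prednK ?subn_gt0// (leq_trans (leq_subr _ _)).
move=> yM jk; case: (ltngtP (y j) (y k)) => [|kj|jkE]; first exact: gt_neq0.
  by rewrite -invf_div thV_eq0 ?gt_neq0// mulf_neq0 ?invr_eq0 ?shift_neq0.
rewrite /shift jkE -mulf_div divff ?expf_neq0// mulr1; exact: z_neq0.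
Qed.

Definition unit_add (k : 'I_n) (x : 'I_n -> nat) (j : 'I_n) := (x j + (j == k))%N.

(** The ratio of neighbouring terms, arranged for the recursion: up to the common product of the
    [th (t * v j)] with j different from k, the left side is the term at x + e_k times its weight,
    and the right side is the term at x times the k-th summand of the expansion with parameters
    [a]. *)
Lemma jackson_term_add (x : 'I_n -> nat) (k : 'I_n) :
  (forall i, x i < M)%N ->
  jackson_term (unit_add k x) *
    (th (b * shift z x k) * \prod_(j < n) th (q * shift z x k / z j)) *
    \prod_(j < n | j != k) (th (q * shift z x k / shift z x j))^-1 =
  jackson_term x * (\prod_(j < n.+1) th (a j * shift z x k)) *
    \prod_(j < n | j != k) (th (shift z x k / shift z x j))^-1.
Proof.
move=> xM; set u := shift z (unit_add k x); set v := shift z x.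
have uk : u k = q * v k.
  by rewrite /u /v /shift /unit_add eqxx addn1 exprS mulrCA.
have uv j : j != k -> u j = v j.
  by rewrite /u /v /shift /unit_add => /negPf ->; rewrite addn0.
have xM' i : (x i <= M)%N by rewrite ltnW.
have xSM i : (unit_add k x i <= M)%N.
  by rewrite /unit_add (leq_trans _ (xM i))// -addn1 leq_add2l leq_b1.
have v0 i : v i != 0 by exact: shift_neq0.
have u0 i : u i != 0 by exact: shift_neq0.
have V := vdm_change1 v0 (u0 k) uv.
have D1 : \prod_(j < n | j != k) th (v k / v j) != 0.
  by apply/prodf_neq0 => j jk; apply: shift_ratio_neq0.
have D2 : \prod_(j < n | j != k) th (u k / v j) != 0.
  by apply/prodf_neq0 => j jk; rewrite -(uv j jk); apply: shift_ratio_neq0.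
have D3 : th (b * v k) != 0 by rewrite /v /shift mulrA bz_neq0.
have vz j : q * v k / z j = q * z k / z j * q ^+ x k.
  by rewrite /v /shift; field.
have D4 : \prod_(j < n) th (q * v k / z j) != 0.
  by apply/prodf_neq0 => j _; rewrite vz qz_neq0.
pose A (y : 'I_n -> nat) i := (\prod_(j < n.+1) poch (a j * z i) (y i)) /
    (poch (b * z i) (y i) * \prod_(j < n) poch (q * z i / z j) (y i)).
have termE y : jackson_term y = vdm (shift z y) / vdm z * \prod_(i < n) A y i by [].
rewrite !termE -/u -/v -!uk !prodfV.
have -> : vdm u = vdm v * \prod_(j < n | j != k) th (u k / v j) /
    \prod_(j < n | j != k) th (v k / v j).
  by rewrite -V mulfK.
rewrite [\prod_(i < n) A (unit_add k x) i](bigD1 k)//= [\prod_(i < n) A x i](bigD1 k)//=.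
have -> : \prod_(i < n | i != k) A (unit_add k x) i = \prod_(i < n | i != k) A x i.
  by apply: eq_bigr => i /negPf ik; rewrite /A /unit_add ik addn0.
have -> : A (unit_add k x) k = A x k * (\prod_(j < n.+1) th (a j * v k)) /
    (th (b * v k) * \prod_(j < n) th (u k / z j)).
  rewrite /A /unit_add eqxx addn1.
  under eq_bigr do rewrite pochS.
  under [X in _ / (_ * X) = _]eq_bigr do rewrite pochS.
  rewrite pochS !big_split /=.
  have -> : \prod_(j < n.+1) th (a j * v k) = \prod_(j < n.+1) th (a j * z k * q ^+ x k).
    by apply: eq_bigr => j _; rewrite mulrA.
  have -> : \prod_(j < n) th (u k / z j) = \prod_(j < n) th (q * z k / z j * q ^+ x k).
    by apply: eq_bigr => j _; rewrite uk vz.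
  have -> : th (b * v k) = th (b * z k * q ^+ x k) by rewrite /v /shift mulrA.
  by rewrite [X in _ / X = _]mulrACA -[LHS]mulf_div mulrA.
by rewrite uk in D2 D4 *; move: (vdm z)^-1 => iv; field; rewrite D1 D2 D4 D3.
Qed.

Definition jackson_sum N :=
  \sum_(y : {ffun 'I_n -> 'I_M.+1} | (\sum_(k < n) y k)%N == N) jackson_term (fun k => y k).

Let upd (f : nat -> nat) k (x : {ffun 'I_n -> 'I_M.+1}) : {ffun 'I_n -> 'I_M.+1} :=
  [ffun j => if j == k then inord (f (x j)) else x j].

(** Adding e_k is a bijection from |x| = N onto the y with |y| = N + 1 and y k > 0; the remaining y
    contribute nothing. *)
Lemma sum_unit_add N k (G : ('I_n -> nat) -> F) : (N < M)%N ->
  (forall y y', y =1 y' -> G y = G y') -> (forall y, y k = 0%N -> G y = 0) ->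
  \sum_(y : {ffun 'I_n -> 'I_M.+1} | (\sum_(i < n) y i)%N == N.+1) G (fun i => y i) =
  \sum_(x : {ffun 'I_n -> 'I_M.+1} | (\sum_(i < n) x i)%N == N) G (unit_add k (fun i => x i)).
Proof.
move=> NM Gext G0.
have upE (x : {ffun 'I_n -> 'I_M.+1}) : (x k < M)%N ->
    (fun i => upd succn k x i : nat) =1 unit_add k (fun i => x i).
  move=> xM i; rewrite ffunE /unit_add; case: eqVneq => [->|_]; last by rewrite addn0.
  by rewrite inordK// addn1.
have sumE (x : {ffun 'I_n -> 'I_M.+1}) : (x k < M)%N ->
    (\sum_(i < n) upd succn k x i = (\sum_(i < n) x i).+1)%N.
  move=> /upE xE; rewrite (eq_bigr _ (fun i _ => xE i)) /unit_add big_split /=.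
  by rewrite -big_mkcond big_pred1_eq addn1.
rewrite (bigID (fun y : {ffun 'I_n -> 'I_M.+1} => y k == 0%N :> nat))/=.
rewrite big1 ?add0r => [|y /andP[_ /eqP yk]]; last exact: G0.
rewrite (reindex_onto (upd succn k) (upd predn k)) => [|y /andP[_ yk]]; last first.
  apply/ffunP => i; rewrite !ffunE; case: eqVneq => // ->.
  have h : ((y k).-1 < M.+1)%N by rewrite (leq_ltn_trans (leq_pred _)).
  by rewrite (inordK h) prednK ?lt0n// inord_val.
apply: eq_big => [x|x /andP[/andP[_ xk] _]].
  have [xM|xM] := ltnP (x k) M.
    rewrite sumE// eqSS; have -> : upd succn k x k != 0%N :> nat.
      by rewrite upE// /unit_add eqxx addn1.
    rewrite andbT; have -> : upd predn k (upd succn k x) == x; last by rewrite andbT.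
    apply/eqP/ffunP => i; rewrite !ffunE; case: eqVneq => // ->.
    by apply: val_inj; rewrite /= !inordK//= ltnW.
  have xkM : x k = M :> nat by apply/eqP; rewrite eqn_leq xM -ltnS ltn_ord.
  have -> : ((\sum_(i < n) x i)%N == N) = false.
    apply/negbTE; rewrite neq_ltn; apply/orP; right.
    by rewrite (leq_trans NM)// (leq_trans xM)// (bigD1 k)//= leq_addr.
  (* [inord] sends the out-of-range value M + 1 to 0, so the updated entry would violate the
     condition of being nonzero. *)
  apply/negP => /andP[/andP[_ +] _].
  by rewrite ffunE eqxx xkM /inord /insubd insubN//= -leqNgt.
apply: Gext => i; apply: upE.
rewrite ltn_neqAle -ltnS ltn_ord andbT; apply: contraNN xk => /eqP xM.
by rewrite ffunE eqxx xM /inord /insubd insubN//= -leqNgt.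
Qed.

(** Both expansions have the same total product [t]: the parameters b / q and 1 / z_j with nodes z
    q^y, |y| = N + 1, and the parameters a_j with nodes z q^x, |x| = N, where the balancing
    condition enters. *)
Lemma jackson_sumS N : (N < M)%N ->
  th (q * q ^+ N) * \prod_(k < n) th (b * z k * q ^+ N) * jackson_sum N.+1 =
  \prod_(j < n.+1) th (b / a j * q ^+ N) * jackson_sum N.
Proof.
move=> NM.
pose t := b * q ^+ N.
(* The weights [w k] sum to a constant on |y| = N + 1 and [w k y] vanishes when
   [y k = 0]. *)
pose w k (y : 'I_n -> nat) :=
  th (b * shift z y k / q) * (\prod_(j < n) th (shift z y k / z j)) *
  \prod_(j < n | j != k) (th (t * shift z y j) / th (shift z y k / shift z y j)).
have shift_prod (y : 'I_n -> nat) :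
    \prod_(k < n) shift z y k = (\prod_(k < n) z k) * q ^+ (\sum_(k < n) y k)%N.
  by rewrite big_split /= -expr_sum.
have ord_le (y : {ffun 'I_n -> 'I_M.+1}) i : (y i <= M)%N by rewrite -ltnS.
have w_sum (y : {ffun 'I_n -> 'I_M.+1}) : (\sum_(k < n) y k)%N == N.+1 ->
    \sum_(k < n) w k (fun i => y i) =
    th (q * q ^+ N) * \prod_(k < n) th (b * z k * q ^+ N).
  move=> /eqP yN.
  have := @partial_fractions_ord n (shift z (fun i => y i))
    (b / q :: [seq (z j)^-1 | j <- index_enum 'I_n]) t.
  rewrite /= size_map size_index_ord !big_cons !big_map => PF.
  transitivity (th (t / (b / q)) * \prod_(j < n) th (t / (z j)^-1)); last first.
    congr (th _ * _); first by rewrite /t; field; rewrite b0 q0.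
    by apply: eq_bigr => j _; rewrite invrK mulrAC.
  rewrite -PF => [|//|x|k|j k jk|].
  - apply: eq_bigr => k _; rewrite /w big_cons big_map.
    congr (th _ * _ * _); first by rewrite mulrAC.
    by apply: eq_bigr => j _; rewrite mulrC.
  - by rewrite inE => /predU1P[->|/mapP[j _ ->]]; rewrite ?mulf_neq0 ?invr_eq0.
  - exact: shift_neq0.
  - exact: shift_ratio_neq0.
  - rewrite shift_prod yN prodfV exprS.
    have Z0 : \prod_(k < n) z k != 0 by apply/prodf_neq0.
    by rewrite /t; field; rewrite Z0 q0.
transitivity (\sum_(y : {ffun 'I_n -> 'I_M.+1} | (\sum_(k < n) y k)%N == N.+1)
    \sum_(k < n) jackson_term (fun i => y i) * w k (fun i => y i)).
  rewrite /jackson_sum mulr_sumr; apply: eq_bigr => y /w_sum <-.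
  by rewrite mulrC mulr_sumr.
rewrite exchange_big /=.
under eq_bigr => k _.
  rewrite (sum_unit_add (k := k) (G := fun y => jackson_term y * w k y)) => //; last 2 first.
  - by move=> y y' /funext ->.
  (* When y k = 0 the factor j = k of the middle product is [th 1]. *)
  - move=> y yk; rewrite /w (bigD1 (F := fun j => th (_ / z j)) k)//=.
    by rewrite /shift yk expr0 mulr1 divff// th1 !(mul0r, mulr0).
  over.
rewrite exchange_big /= /jackson_sum mulr_sumr; apply: eq_bigr => x /eqP xN.
pose v := shift z (fun i => x i).
have xM i : (x i < M)%N.
  by rewrite (leq_ltn_trans _ NM)// -xN (bigD1 i)//= leq_addr.
have v0 i : v i != 0 by exact: shift_neq0.
have hv j k : j != k -> th (v k / v j) != 0 by exact: shift_ratio_neq0.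
have := @partial_fractions_ord n v [seq a j | j <- index_enum 'I_n.+1] t.
rewrite size_map size_index_ord !big_map => PF.
transitivity (\prod_(j < n.+1) th (t / a j) * jackson_term (fun i => x i)); last first.
  by congr (_ * _); apply: eq_bigr => j _; rewrite /t mulrAC.
rewrite -PF => [|//|y /mapP[j _ ->]//|//|//|]; last first.
  by rewrite shift_prod xN mulrA -balanced.
rewrite mulrC mulr_sumr; apply: eq_bigr => k _; rewrite big_map.
pose u := shift z (unit_add k (fun i => x i)).
have uk : u k = q * v k.
  by rewrite /u /v /shift /unit_add eqxx addn1 exprS mulrCA.
have uv j : j != k -> u j = v j.
  by rewrite /u /v /shift /unit_add => /negPf ->; rewrite addn0.
rewrite [in RHS]big_split /=.
transitivity (jackson_term (fun i => x i) * (\prod_(j < n.+1) th (a j * v k)) *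
    \prod_(j < n | j != k) (th (v k / v j))^-1 * \prod_(j < n | j != k) th (t * v j)); last first.
  by rewrite [X in _ = _ * (_ * X)]mulrC !mulrA.
rewrite -(jackson_term_add k xM) -/v /w -/u uk.
have -> : b * (q * v k) / q = b * v k by field.
have -> : \prod_(j < n | j != k) (th (t * u j) / th (q * v k / u j)) =
    \prod_(j < n | j != k) th (t * v j) * \prod_(j < n | j != k) (th (q * v k / v j))^-1.
  by rewrite -big_split /=; apply: eq_bigr => j /uv ->.
by rewrite !mulrA [LHS]mulrAC.
Qed.

Theorem jackson_summation N : (N <= M)%N ->
  vdm z != 0 -> (forall i, (i < M)%N -> th (q * q ^+ i) != 0) ->
  jackson_sum N = (\prod_(j < n.+1) poch (b / a j) N) /
    (poch q N * \prod_(k < n) poch (b * z k) N).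
Proof.
move=> NM vdm0 hq; elim: N NM => [_|N IHN NM].
  have poch0 x : poch x 0 = 1 by rewrite /poch big_geq.
  rewrite /jackson_sum (big_pred1 [ffun=> ord0]) => [|y]; last first.
    rewrite sum_nat_eq0; apply/forallP/eqP => [h|-> k]; last by rewrite ffunE.
    by apply/ffunP => k; rewrite ffunE; apply/val_inj/eqP; have := h k.
  rewrite /jackson_term; have -> : shift z (fun k => [ffun=> ord0 : 'I_M.+1] k) = z.
    by apply/funext => k; rewrite /shift ffunE mulr1.
  rewrite divff// mul1r poch0 mul1r !big1 ?divr1// => k _; rewrite ?ffunE ?poch0//.
  by rewrite !big1 ?mul1r ?invr1 // => j _; rewrite poch0.
have D0 : th (q * q ^+ N) * \prod_(k < n) th (b * z k * q ^+ N) != 0.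
  by rewrite mulf_neq0 ?hq//; apply/prodf_neq0 => k _; apply: bz_neq0.
apply: (mulfI D0); rewrite jackson_sumS// IHN ?(ltnW NM)//.
under [X in _ = _ * (X / _)]eq_bigr do rewrite pochS.
under [X in _ = _ * (_ / (_ * X))]eq_bigr do rewrite pochS.
rewrite pochS !big_split /=.
have P0 : poch q N * \prod_(k < n) poch (b * z k) N != 0.
  rewrite mulf_neq0//; first by apply/poch_neq0P => i iN; rewrite hq ?(ltn_trans iN).
  apply/prodf_neq0 => k _; apply/poch_neq0P => i iN.
  by rewrite bz_neq0 ?(ltn_trans iN).
rewrite [X in _ = _ * (_ / X)]mulrACA -[in RHS]mulf_div.
by rewrite mulrC [RHS]mulrC -[RHS]mulrA divfK// -mulrA.
Qed.
End Jackson.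
End PartialFractions.

(** * Convergence of the theta product *)

Section ComplexSequences.
Local Open Scope classical_set_scope.
Variable R : realType.
Local Notation K := (R[i]%C : numFieldType).
Local Notation N := (@Normc.normc R).
Implicit Types (u v : nat -> K) (l : K).

Lemma normc_ge0 (x : R[i]) : 0 <= N x.
Proof. by case: x => a b; exact: sqrtr_ge0. Qed.

Lemma normrc (x : R[i]) : `|x| = (N x)%:C%C.
Proof. by []. Qed.

Lemma normc_neq0 (x : R[i]) : (N x == 0) = (x == 0).
Proof.
by apply/eqP/eqP => [/Normc.eq0_normc//|->]; rewrite Normc.normc0.
Qed.

Lemma normcX (x : R[i]) n : N (x ^+ n) = N x ^+ n.
Proof. by elim: n => [|n IH]; rewrite ?expr0 ?Normc.normc1// !exprS Normc.normcM IH. Qed.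

Lemma normc_sum (I : Type) (s : seq I) (P : pred I) (f : I -> R[i]) :
  N (\sum_(i <- s | P i) f i) <= \sum_(i <- s | P i) N (f i).
Proof.
elim/big_rec2 : _ => [|i x y _ h]; first by rewrite Normc.normc0.
by rewrite (le_trans (le_normcD _ _))// lerD2l.
Qed.

Lemma normc_Re_le (x : R[i]) : `|complex.Re x| <= N x.
Proof.
case: x => a b /=; rewrite -sqrtr_sqr ler_sqrt ?addr_ge0 ?sqr_ge0//.
by rewrite lerDl sqr_ge0.
Qed.

Lemma normc_Im_le (x : R[i]) : `|complex.Im x| <= N x.
Proof.
case: x => a b /=; rewrite -sqrtr_sqr ler_sqrt ?addr_ge0 ?sqr_ge0//.
by rewrite lerDr sqr_ge0.
Qed.

(** The norm of [R[i]] as a normed field is complex-valued; the estimates below are made with the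
    real-valued [normc] and a real epsilon. *)
Lemma cvgcP u l : u @ \oo --> l <->
  forall e : R, 0 < e -> \forall n \near \oo, N (l - u n) < e.
Proof.
split=> [/cvgrPdist_lt h e e0|h].
  have := h (e%:C)%C; rewrite ltcR => /(_ e0).
  by apply: filterS => n; rewrite normrc ltcR.
apply/cvgrPdist_lt => e e0.
have eE : e = (complex.Re e)%:C%C.
  by move: e0; case: e => a b; rewrite ltcE /= => /andP[/eqP -> _].
rewrite eE ltcR in e0; have := h _ e0; rewrite eE.
by apply: filterS => n; rewrite normrc ltcR.
Qed.

(** Real and imaginary parts are telescoping series dominated by a geometric one. *)
Lemma cvgc_geometric u (C r : R) : 0 <= r < 1 ->
  (forall n, N (u n.+1 - u n) <= C * r ^+ n) -> cvgn u.
Proof.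
move=> /andP[r0 r1] h.
have real_cvg (f : nat -> R) : (forall n, `|f n.+1 - f n| <= C * r ^+ n) -> cvgn f.
  move=> fh; have -> : f = cst (f 0%N) + series (telescope f).
    by apply/funext => n; exact: eq_sum_telescope.
  apply: is_cvgD; first exact: is_cvg_cst.
  apply: normed_cvg; apply: (series_le_cvg (v_ := geometric C r)).
  - by move=> n /=.
  - by move=> n; rewrite /= (le_trans _ (fh n)).
  - exact: fh.
  - by apply: is_cvg_geometric_series; rewrite ger0_norm.
have /cvg_ex[a /cvgrPdist_lt ha] : cvgn (fun n => complex.Re (u n)).
  apply: real_cvg => n; apply: le_trans (h n).
  by rewrite -raddfB; exact: normc_Re_le.
have /cvg_ex[b /cvgrPdist_lt hb] : cvgn (fun n => complex.Im (u n)).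
  apply: real_cvg => n; apply: le_trans (h n).
  by rewrite -raddfB; exact: normc_Im_le.
apply/cvg_ex; exists ((a +i* b)%C : K); apply/cvgcP => e e0.
have e2 : 0 < e / 2 by rewrite divr_gt0.
have := ha _ e2; have {hb} := hb _ e2 => hb {}ha.
near=> n.
have han : `|a - complex.Re (u n)| < e / 2 by near: n.
have hbn : `|b - complex.Im (u n)| < e / 2 by near: n.
have -> : (a +i* b)%C - u n = (a - complex.Re (u n))%:C%C + 'i%C * (b - complex.Im (u n))%:C%C.
  by case: (u n) => c d; simpc.
apply: le_lt_trans (le_normcD _ _) _.
rewrite Normc.normcM /= !expr0n /= !addr0 !sqrtr_sqr expr1n add0r sqrtr1 mul1r; lra.
Unshelve. all: by end_near.
Qed.

Lemma sum_geometric_le (r : R) n : 0 <= r < 1 -> \sum_(0 <= j < n) r ^+ j <= (1 - r)^-1.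
Proof.
move=> /andP[r0 r1]; rewrite -[leRHS]mul1r ler_pdivlMr ?subr_gt0//.
have -> : (\sum_(0 <= j < n) r ^+ j) * (1 - r) = 1 - r ^+ n.
  elim: n => [|n IH]; first by rewrite big_geq// mul0r expr0 subrr.
  by rewrite big_nat_recr//= mulrDl IH exprS; ring.
by rewrite gerBl exprn_ge0.
Qed.

(** The product is bounded by the exponential of the sum of the [N (u j)], which is at most C / (1 -
    r). *)
Lemma prod1D_bounded (u : nat -> R[i]) (C r : R) : 0 <= r < 1 ->
  (forall j, N (u j) <= C * r ^+ j) ->
  exists B, forall n, N (\prod_(0 <= j < n) (1 + u j)) <= B.
Proof.
move=> r01 h; have C0 : 0 <= C.
  by have := h 0%N; rewrite expr0 mulr1; apply: le_trans; exact: normc_ge0.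
exists (expR (C / (1 - r))) => n.
apply: (@le_trans _ _ (expR (C * \sum_(0 <= j < n) r ^+ j))); last first.
  by rewrite ler_expR ler_wpM2l// sum_geometric_le.
rewrite mulr_sumr expR_sum; elim: n => [|n IH].
  by rewrite !big_geq// Normc.normc1.
rewrite !big_nat_recr//= Normc.normcM ler_pM// ?normc_ge0//.
apply: le_trans (le_normcD _ _) _; rewrite Normc.normc1.
by apply: le_trans (expR_ge1Dx _); rewrite lerD2l.
Qed.

Lemma prod1D_cvg (u : nat -> R[i]) (C r : R) : 0 <= r < 1 ->
  (forall j, N (u j) <= C * r ^+ j) ->
  cvgn (fun n => \prod_(0 <= j < n) (1 + u j) : K).
Proof.
move=> r01 h; have [B hB] := prod1D_bounded r01 h.
apply: (@cvgc_geometric _ (B * C) r r01) => n.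
rewrite big_nat_recr//= mulrDr mulr1 addrC addKr Normc.normcM -mulrA.
by rewrite ler_pM ?normc_ge0.
Qed.

Lemma bounded_of_eventually (f : nat -> R) (D : R) :
  (\forall n \near \oo, f n <= D) -> exists B, forall n, f n <= B.
Proof.
move=> [n0 _ h]; exists (`|D| + \sum_(0 <= j < n0) `|f j|) => n.
have [n0n|nn0] := leqP n0 n.
  apply: le_trans (h _ n0n) _; rewrite (le_trans (ler_norm D))// lerDl.
  by rewrite sumr_ge0.
apply: le_trans (ler_norm _) _; rewrite big_mkord (bigD1 (Ordinal nn0))//=.
by rewrite addrCA lerDl addr_ge0// sumr_ge0.
Qed.

(** The inverse factor is 1 - u_j / (1 + u_j), again 1 plus a geometrically small term, because 1 /
    (1 + u_j) is eventually at most 2. This keeps infinite products without zero factors away from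
    0. *)
Lemma prod1D_inv_bounded (u : nat -> R[i]) (C r : R) : 0 <= r < 1 ->
  (forall j, N (u j) <= C * r ^+ j) -> (forall j, 1 + u j != 0) ->
  exists B, forall n, N (\prod_(0 <= j < n) (1 + u j))^-1 <= B.
Proof.
move=> r01 h u0; have /andP[r0 r1] := r01.
have [D hD] : exists D, forall j, (N (1 + u j))^-1 <= D.
  apply: (@bounded_of_eventually _ 2).
  have : geometric C r @ \oo --> (0 : R) by apply: cvg_geometric; rewrite ger0_norm.
  move=> /cvgrPdist_lt /(_ (2^-1)); rewrite invr_gt0 => /(_ (ltr0n _ _)).
  apply: filterS => j; rewrite sub0r normrN => hj.
  have uj : N (u j) < 2^-1.
    by apply: le_lt_trans hj; rewrite (le_trans (h j))// ler_norm.
  have : 1 <= N (1 + u j) + N (u j).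
    rewrite -[X in X <= _](Normc.normc1 R) -[X in N X](addrK (u j)).
    by rewrite (le_trans (le_normcD _ _))// normcN.
  by move=> h1; rewrite invf_ple ?posrE//; lra.
have h' j : N ((1 + u j)^-1 - 1) <= (D * C) * r ^+ j.
  have -> : (1 + u j)^-1 - 1 = (1 + u j)^-1 * (- u j).
    by apply: (mulfI (u0 j)); rewrite mulrBr mulrA mulfV// mul1r; ring.
  by rewrite Normc.normcM normcN Normc.normcV -mulrA ler_pM ?invr_ge0 ?normc_ge0.
have [B hB] := prod1D_bounded r01 h'; exists B => n.
rewrite -prodfV (le_trans _ (hB n))//.
by under [X in _ <= N X]eq_bigr do rewrite addrC subrK.
Qed.

(** * Functional equations and zeros of theta *)

Section QPochhammer.
Variable p : R[i].
Hypothesis hp : `|p| < 1.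

Definition qpoch (x : R[i]) (m : nat) : R[i] := \prod_(0 <= j < m) (1 - p ^+ j * x).
Definition qpoch_inf (x : R[i]) : R[i] := lim ((qpoch x : nat -> K) @ \oo).

Lemma normc_p_lt1 : 0 <= N p < 1.
Proof. by rewrite normc_ge0 -ltcR. Qed.

Let bound x j : N (- (p ^+ j * x)) <= N x * N p ^+ j.
Proof. by rewrite normcN Normc.normcM normcX mulrC. Qed.

Lemma qpoch_cvg x : (qpoch x : nat -> K) @ \oo --> (qpoch_inf x : K).
Proof. exact: prod1D_cvg normc_p_lt1 (bound x). Qed.

Lemma qpoch_bounded x : exists B, forall n, N (qpoch x n) <= B.
Proof. exact: prod1D_bounded normc_p_lt1 (bound x). Qed.

Lemma qpoch_inv_bounded x : (forall j, p ^+ j * x != 1) ->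
  exists B, forall n, N (qpoch x n)^-1 <= B.
Proof.
move=> h; apply: prod1D_inv_bounded normc_p_lt1 (bound x) _ => j.
by rewrite subr_eq0 eq_sym.
Qed.

(** If no factor vanishes, the inverses of the partial products are bounded, so the partial products
    cannot approach 0. *)
Lemma qpoch_inf_eq0 x : qpoch_inf x = 0 <-> exists j, p ^+ j * x = 1.
Proof.
split=> [x0|[j jx]]; last first.
  apply: (@cvg_lim K (@norm_hausdorff K K)).
  apply: cvg_near_cst; exists j.+1 => // n /= jn.
  by rewrite /qpoch big_mkord (bigD1 (Ordinal jn))//= jx subrr mul0r.
apply: contrapT => nex; have h i : p ^+ i * x != 1.
  by apply/eqP => ix; exact: (nex (ex_intro _ i ix)).
have [B hB] : exists B, forall n, N (qpoch x n)^-1 <= B.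
  exact: qpoch_inv_bounded.
have B0 : 0 < B.
  have := hB 0%N; rewrite /qpoch big_geq// invr1 Normc.normc1.
  by apply: lt_le_trans.
have /cvgcP/(_ B^-1) := @qpoch_cvg x; rewrite invr_gt0 x0 => /(_ B0) [n _ /(_ n (leqnn n))] /=.
rewrite sub0r normcN ltNge => /negP; apply.
have qn0 : qpoch x n != 0.
  by rewrite prodf_seq_neq0; apply/allP => j _; rewrite subr_eq0 eq_sym h.
have := hB n; rewrite Normc.normcV invf_ple// posrE lt0r normc_ge0 andbT.
by rewrite normc_neq0.
Qed.

Lemma qpoch_infS x : qpoch_inf x = (1 - x) * qpoch_inf (p * x).
Proof.
apply: (@cvg_lim K (@norm_hausdorff K K)).
rewrite -(@cvg_shiftS K).
have -> : (fun n => qpoch x n.+1) = (fun n => (1 - x) * qpoch (p * x) n).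
  apply/funext => n; rewrite /qpoch big_nat_recl//= expr0 mul1r; congr (_ * _).
  by apply: eq_bigr => i _; rewrite exprSr mulrA.
exact: (cvgMr (@qpoch_cvg (p * x))).
Qed.

Lemma theta_qpoch x : theta (K := K) p x = qpoch_inf x * qpoch_inf (p / x).
Proof.
apply: (@cvg_lim K (@norm_hausdorff K K)).
have -> : (fun m => \prod_(0 <= j < m) ((1 - p ^+ j * x) * (1 - p ^+ j.+1 / x))) =
    (fun m => qpoch x m * qpoch (p / x) m).
  apply/funext => m; rewrite big_split /=; congr (_ * _).
  by apply: eq_bigr => i _; rewrite exprSr mulrA.
exact: (cvgM (@qpoch_cvg _) (@qpoch_cvg _)).
Qed.

Lemma theta_nome0 x : p = 0 -> theta (K := K) p x = 1 - x.
Proof.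
move=> p0; have qpoch_inf0 : qpoch_inf 0 = 1.
  apply: (@cvg_lim K (@norm_hausdorff K K)); apply: cvg_near_cst.
  by apply: nearW => m; rewrite /qpoch big1// => j _; rewrite mulr0 subr0.
by rewrite theta_qpoch qpoch_infS p0 !mul0r qpoch_inf0 !mulr1.
Qed.

Lemma theta1 : theta (K := K) p 1 = 0.
Proof. by rewrite theta_qpoch qpoch_infS subrr !mul0r. Qed.

Lemma thetaV x : x != 0 -> theta (K := K) p x^-1 = - (x^-1 * theta (K := K) p x).
Proof.
move=> x0; rewrite !theta_qpoch qpoch_infS (qpoch_infS x) invrK.
by field.
Qed.

(** The zeros are the integer powers of [p], split by the sign of the exponent to avoid inverting
    [p], which may be 0. *)
Lemma theta_eq0 x : x != 0 -> theta (K := K) p x = 0 <->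
  (exists j, p ^+ j * x = 1) \/ (exists j, p ^+ j.+1 = x).
Proof.
move=> x0; rewrite theta_qpoch; split=> [/eqP|].
  rewrite mulf_eq0 => /orP[] /eqP /qpoch_inf_eq0; first by left.
  by move=> [j jx]; right; exists j; rewrite exprSr -[RHS]mul1r -jx mulrA divfK.
case=> [/qpoch_inf_eq0 ->|[j jx]]; first by rewrite mul0r.
have -> : qpoch_inf (p / x) = 0; last by rewrite mulr0.
by apply/qpoch_inf_eq0; exists j; rewrite mulrA -exprSr jx divff.
Qed.

(** The zeros form a multiplicative group, the powers of [p], reduced to 1 when p = 0. [mixed]
    multiplies two zeros with exponents of opposite sign. *)
Lemma theta_div_eq0 x y : x != 0 -> y != 0 -> theta (K := K) p x = 0 ->
  theta (K := K) p y = 0 -> theta (K := K) p (x / y) = 0.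
Proof.
have mixed z w : w != 0 -> (exists j, p ^+ j * z = 1) -> (exists j, p ^+ j.+1 = w) ->
    theta (K := K) p (z * w) = 0.
  move=> w0 [j jz] [i iw].
  have z0 : z != 0.
    by apply: contraPneq jz => ->; rewrite mulr0 => /eqP; rewrite eq_sym oner_eq0.
  have pj0 : p ^+ j != 0.
    by apply: contraPneq jz => ->; rewrite mul0r => /eqP; rewrite eq_sym oner_eq0.
  apply/theta_eq0; first by rewrite mulf_neq0.
  have [ij|ij] := ltnP i j.
    left; exists (j - i.+1)%N.
    by rewrite -iw [z * _]mulrC mulrA -exprD subnK.
  right; exists (i - j)%N.
  by apply: (mulfI pj0); rewrite -exprD addnS subnKC// mulrA jz mul1r iw.
move=> x0 y0 hx hy; have yV0 : y^-1 != 0 by rewrite invr_eq0.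
have hyV : theta (K := K) p y^-1 = 0 by rewrite thetaV// hy mulr0 oppr0.
case/(theta_eq0 x0): hx => hx; case/(theta_eq0 yV0): hyV => hyV; first 2 last.
- by rewrite mulrC; exact: mixed.
- case: hx hyV => [j jx] [i iy]; apply/theta_eq0; first by rewrite mulf_neq0.
  by right; exists (j + i.+1)%N; rewrite -addSn exprD jx iy.
- case: hx hyV => [j jx] [i iy]; apply/theta_eq0; first by rewrite mulf_neq0.
  by left; exists (j + i)%N; rewrite exprD mulrACA jx iy mulr1.
- exact: mixed.
Qed.
End QPochhammer.
End ComplexSequences.

(** * The three-term identity for theta *)

Section TripleProduct.
Local Open Scope classical_set_scope.
Variable R : realType.
Local Notation K := (R[i]%C : numFieldType).
Local Notation N := (@Normc.normc R).
(* The nome is [p = s ^+ 2], so that [p ^ (k (k - 1) / 2) = s ^ (k (k - 1))]. *)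
Variable s : R[i].
Hypothesis s0 : s != 0.
Hypothesis s1 : N s < 1.

Let p := s ^+ 2.

Let p0 : p != 0. Proof. by rewrite expf_neq0. Qed.

Lemma normc_sqr_lt1 : `|p| < 1.
Proof. by rewrite normrc ltcR normcX exprn_ilt1 ?normc_ge0. Qed.

Lemma exprp_neq1 j : p ^+ j.+1 != 1.
Proof.
apply/eqP => /(congr1 N)/eqP; rewrite normcX Normc.normc1 lt_eqF//.
by rewrite exprn_ilt1 ?normc_ge0// normcX exprn_ilt1 ?normc_ge0.
Qed.

Lemma qpochS x n : qpoch p x n.+1 = qpoch p x n * (1 - p ^+ n * x).
Proof. by rewrite /qpoch big_nat_recr. Qed.

Definition qfact n := qpoch p p n.

Lemma qfactS n : qfact n.+1 = qfact n * (1 - p ^+ n.+1).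
Proof. by rewrite /qfact qpochS -exprSr. Qed.

Lemma qfact0 : qfact 0 = 1.
Proof. by rewrite /qfact /qpoch big_geq. Qed.

Lemma qfact_neq0 n : qfact n != 0.
Proof.
elim: n => [|n IH]; first by rewrite qfact0 oner_eq0.
by rewrite qfactS mulf_neq0// subr_eq0 eq_sym exprp_neq1.
Qed.

(** The Gaussian binomial coefficient in base [p], meaningful for i <= n. *)
Definition gbin n i := qfact n / (qfact i * qfact (n - i)).

Lemma gbin0 n : gbin n 0 = 1.
Proof. by rewrite /gbin subn0 qfact0 mul1r divff ?qfact_neq0. Qed.

Lemma gbinnn n : gbin n n = 1.
Proof. by rewrite /gbin subnn qfact0 mulr1 divff ?qfact_neq0. Qed.

(** A q-Pascal rule at n = i + k + 1. The factor [p ^+ i] is the one by which the powers p^C(i+1, 2)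
    and p^C(i, 2) differ when coefficients are compared. *)
Lemma gbinS i k : gbin (i + k).+2 i.+1 * p ^+ i =
  gbin (i + k).+1 i.+1 * p ^+ i + p ^+ (i + k).+1 * gbin (i + k).+1 i.
Proof.
rewrite /gbin; have -> : ((i + k).+2 - i.+1 = k.+1)%N by lia.
have -> : ((i + k).+1 - i.+1 = k)%N by lia.
have -> : ((i + k).+1 - i = k.+1)%N by lia.
rewrite (qfactS (i + k).+1) (qfactS i) (qfactS k).
have := exprp_neq1 i; have := exprp_neq1 k.
rewrite ![_ == 1]eq_sym -![1 == _]subr_eq0 => h1 h2.
move: h1 h2 (qfact_neq0 i) (qfact_neq0 k); rewrite !exprS exprD.
move: (qfact _) (qfact i) (qfact k) (p ^+ i) (p ^+ k) => a b c d e h1 h2 b0 c0.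
by field; rewrite b0 c0 h1 h2.
Qed.

(** Rothe's finite q-binomial theorem, by induction through the q-Pascal rule. *)
Lemma qpoch_expand x n :
  qpoch p x n = \sum_(0 <= i < n.+1) gbin n i * (-1) ^+ i * p ^+ 'C(i, 2) * x ^+ i.
Proof.
elim: n => [|n IH].
  by rewrite /qpoch big_geq// big_nat1 gbin0 !expr0 !mulr1.
rewrite qpochS mulrBr mulr1 {1}IH.
rewrite IH [X in X - _]big_nat_recl// [X in _ - X * _]big_nat_recr//=.
rewrite [in RHS]big_nat_recl// [in RHS]big_nat_recr//=.
rewrite mulrDl opprD mulr_suml addrACA -addrA; congr (_ + _).
- by rewrite !gbin0.
- rewrite addrA [- _ + _]addrC -sumrB; congr (_ + _).
  + apply: eq_big_nat => i /andP[_ ik].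
    have [k ->] : exists k, n = (i + k).+1 by exists (n - i.+1)%N; lia.
    have := gbinS i k; rewrite binS bin1 exprD.
    rewrite !(exprS _ i) => H.
    transitivity (- (-1) ^+ i * p ^+ 'C(i, 2) * (x * x ^+ i) *
      (gbin (i + k).+1 i.+1 * p ^+ i + p ^+ (i + k).+1 * gbin (i + k).+1 i)); first by ring.
    by rewrite -H; ring.
  + rewrite !gbinnn binS bin1 exprD !exprS; ring.
Qed.

(** The k-th term of the Laurent series in Jacobi's triple product. *)
Definition tterm (k : int) (x : R[i]) : R[i] := (-1) ^ k * s ^ (k * (k - 1)) * x ^ k.

Lemma expr_bin2 i : p ^+ 'C(i, 2) = s ^ (i%:Z * (i%:Z - 1)).
Proof.
elim: i => [|i IH]; first by rewrite bin0n /= mul0r.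
rewrite binS bin1 exprD IH /p -exprM !exprnP -expfzDr//; congr (_ ^ _); lia.
Qed.

Lemma qpoch_mul_shift x m : x != 0 ->
  qpoch p (x / p ^+ m) (m + m) =
  (-1) ^ m%:Z * s ^ (- (m%:Z * (m%:Z + 1))) * x ^ m%:Z * (qpoch p x m * qpoch p (p / x) m).
Proof.
move=> x0; elim: m => [|m IH].
  by rewrite /qpoch !big_geq// mul0r oppr0 !expr0z !mulr1.
rewrite addSn addnS {1}/qpoch big_nat_recl// expr0 mul1r.
have -> : \prod_(0 <= i < (m + m).+1) (1 - p ^+ i.+1 * (x / p ^+ m.+1)) =
    qpoch p (x / p ^+ m) (m + m).+1.
  apply: eq_bigr => i _; congr (1 - _); rewrite !exprS.
  by field; rewrite p0 expf_neq0.
rewrite !qpochS IH.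
have -> : 1 - x / p ^+ m.+1 = - x / p ^+ m.+1 * (1 - p ^+ m * (p / x)).
  by rewrite exprS; field; rewrite x0 p0 expf_neq0.
have -> : p ^+ (m + m) * (x / p ^+ m) = p ^+ m * x.
  by rewrite exprD; field; rewrite expf_neq0.
have -> : (-1 : R[i]) ^ m.+1%:Z = - (-1) ^ m%:Z by rewrite -!exprnP exprS mulN1r.
have -> : x ^ m.+1%:Z = x * x ^ m%:Z by rewrite -!exprnP exprS.
have -> : s ^ (- (m.+1%:Z * (m.+1%:Z + 1))) = s ^ (- (m%:Z * (m%:Z + 1))) / p ^+ m.+1.
  rewrite /p -exprM exprnN -expfzDr//; congr (_ ^ _); lia.
ring.
Qed.

(** The finite triple product: the q-binomial theorem with 2 m factors, applied to x / p^m, which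
    recentres the exponents from 0, ..., 2 m to -m, ..., m. *)
Lemma theta_finite x m : x != 0 ->
  qpoch p x m * qpoch p (p / x) m =
  \sum_(0 <= i < (m + m).+1) gbin (m + m) i * tterm (i%:Z - m%:Z) x.
Proof.
move=> x0; have := qpoch_mul_shift m x0; rewrite qpoch_expand.
have n10 : (-1 : R[i]) != 0 by rewrite oppr_eq0 oner_eq0.
set c := _ * x ^ m%:Z => H.
have c0 : c != 0 by rewrite /c !mulf_neq0 ?expfz_neq0.
apply: (mulfI c0); rewrite -H mulr_sumr; apply: eq_bigr => i _.
rewrite [RHS]mulrCA -!(mulrA (gbin _ _)); congr (_ * _); rewrite expr_bin2 /tterm /c expr_div_n.
have -> : (-1) ^+ i = (-1) ^ m%:Z * (-1) ^ (i%:Z - m%:Z) :> R[i].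
  by rewrite -expfzDr// exprnP; congr (_ ^ _); lia.
have -> : x ^+ i = x ^ m%:Z * x ^ (i%:Z - m%:Z).
  by rewrite -expfzDr// exprnP; congr (_ ^ _); lia.
have -> : s ^ (i%:Z * (i%:Z - 1)) =
    s ^ (- (m%:Z * (m%:Z + 1))) * s ^ ((i%:Z - m%:Z) * (i%:Z - m%:Z - 1)) * (p ^+ m) ^+ i.
  by rewrite -exprM -exprM exprnP -!expfzDr//; congr (_ ^ _); lia.
by field; rewrite !expf_neq0.
Qed.
End TripleProduct.

(** * Dominated convergence over the integer lattice *)

Section Tannery.
Local Open Scope classical_set_scope.
Variable R : realType.
Local Notation K := (R[i]%C : numFieldType).
Local Notation N := (@Normc.normc R).

Lemma sum_uniq_split (V : nmodType) (I : eqType) (s E : seq I) (f : I -> V) :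
  uniq s -> uniq E -> {subset E <= s} ->
  \sum_(i <- s) f i = \sum_(i <- E) f i + \sum_(i <- s | i \notin E) f i.
Proof.
move=> us uE Es; rewrite (bigID (mem E))/=; congr (_ + _).
rewrite -big_filter; apply: perm_big; apply: uniq_perm => //; first exact: filter_uniq.
by move=> i; rewrite mem_filter; apply/andP/idP => [[]//|iE]; split => //; exact: Es.
Qed.

Lemma ler_sum_uniq (I : eqType) (s t : seq I) (w : I -> R) : (forall i, 0 <= w i) ->
  uniq s -> uniq t -> {subset s <= t} -> \sum_(i <- s) w i <= \sum_(i <- t) w i.
Proof. by move=> w0 us ut st; rewrite (sum_uniq_split w ut us st) lerDl sumr_ge0. Qed.

(* Dominated convergence for series over a countable index set, where the two
   families may be summed along different exhaustions [A] and [B]. *)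
Lemma tannery (I : eqType) (w : I -> R) (C : R) (f g : nat -> I -> R[i])
    (A B : nat -> seq I) :
  (forall s, uniq s -> \sum_(i <- s) w i <= C) ->
  (forall n i, N (f n i) <= w i) -> (forall n i, N (g n i) <= w i) ->
  (forall i, (fun n => f n i - g n i : K) @ \oo --> (0 : K)) ->
  (forall n, uniq (A n)) -> (forall n, uniq (B n)) ->
  (forall i, \forall n \near \oo, i \in A n) ->
  (forall i, \forall n \near \oo, i \in B n) ->
  (fun n => \sum_(i <- A n) f n i - \sum_(i <- B n) g n i : K) @ \oo --> (0 : K).
Proof.
move=> wC fw gw fg uA uB iA iB.
have w0 i : 0 <= w i by apply: le_trans (fw 0%N i); exact: normc_ge0.
pose S := [set x : R | exists s, uniq s /\ x = \sum_(i <- s) w i].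
have supS : has_sup S.
  split; first by exists 0, [::]; rewrite big_nil.
  by exists C => _ [s [us ->]]; exact: wC.
apply/cvgcP => e e0; have e3 : 0 < e / 3 by rewrite divr_gt0.
(* The finite set [E] carries all but e / 3 of the weight: the terms of [f] and of [g] outside it
   cost less than e / 3 each, and on [E] pointwise convergence suffices. *)
have [_ [E [uE ->]] hE] := sup_adherent e3 supS.
have tail s : uniq s -> \sum_(i <- s | i \notin E) w i < e / 3.
  move=> us; have : \sum_(i <- E ++ [seq i <- s | i \notin E]) w i <= sup S.
    apply: sup_upper_bound => //; exists (E ++ [seq i <- s | i \notin E]); split => //.
    rewrite cat_uniq uE filter_uniq// andbT; apply/hasPn => i.
    by rewrite mem_filter => /andP[].
  by rewrite big_cat big_filter/=; lra.
have near_all (P : nat -> I -> Prop) : (forall i, \forall n \near \oo, P n i) ->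
    \forall n \near \oo, {in E, forall i, P n i}.
  move=> hP; elim: (E) => [|i s IH]; first by near=> n => i.
  near=> n => j; rewrite inE => /predU1P[->|]; first by near: n; exact: hP.
  by move: j; near: n; exact: IH.
have fgE : (fun n => \sum_(i <- E) (f n i - g n i) : K) @ \oo --> (0 : K).
  elim: (E) => [|i s IH].
    by under eq_fun do rewrite big_nil; exact: cvg_cst.
  under eq_fun do rewrite big_cons; have := cvgD (fg i) IH; rewrite addr0; exact.
move/cvgcP: fgE => /(_ _ e3) fgE.
have EA := near_all (fun n i => i \in A n) iA.
have EB := near_all (fun n i => i \in B n) iB.
near=> n.
have hfg : N (0 - \sum_(i <- E) (f n i - g n i)) < e / 3 by near: n.
have hA : {in E, forall i, i \in A n} by near: n.
have hB : {in E, forall i, i \in B n} by near: n.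
rewrite (sum_uniq_split _ (uA n) uE hA) (sum_uniq_split _ (uB n) uE hB).
rewrite sub0r normcN opprD addrACA -sumrB.
rewrite sub0r normcN in hfg.
have tf : N (\sum_(i <- A n | i \notin E) f n i) < e / 3.
  by apply: le_lt_trans (tail _ (uA n)); apply: le_trans (normc_sum _ _ _) _; exact: ler_sum.
have tg : N (\sum_(i <- B n | i \notin E) g n i) < e / 3.
  by apply: le_lt_trans (tail _ (uB n)); apply: le_trans (normc_sum _ _ _) _; exact: ler_sum.
have := le_normcD (\sum_(i <- E) (f n i - g n i))
  (\sum_(i <- A n | i \notin E) f n i - \sum_(i <- B n | i \notin E) g n i).
have := le_normcD (\sum_(i <- A n | i \notin E) f n i) (- \sum_(i <- B n | i \notin E) g n i).
rewrite normcN; lra.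
Unshelve. all: by end_near.
Qed.

(** Nonnegative integers contribute at most 2 and negative ones at most 1; the bound 4 leaves
    room. *)
Lemma sum_halfX_int (s : seq int) : uniq s -> \sum_(k <- s) (2^-1 : R) ^+ `|k|%N <= 4.
Proof.
move=> us; have [L hL] : exists L, forall k, k \in s -> (`|k|%N < L)%N.
  by exists (\max_(k <- s) `|k|%N).+1 => k ks; rewrite ltnS; apply: leq_bigmax_seq.
pose t := [seq Posz i | i <- iota 0 L] ++ [seq Negz i | i <- iota 0 L].
have h0 : (0 : R) <= 2^-1 by rewrite invr_ge0.
have ut : uniq t.
  rewrite cat_uniq !map_inj_uniq ?iota_uniq ?andbT /=; try by move=> i j [].
  by apply/hasPn => _ /mapP[i _ ->]; apply/negP => /mapP[].
have st : {subset s <= t}.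
  move=> k ks; have := hL k ks.
  rewrite mem_cat; case: k {ks} => k kL; apply/orP; [left|right]; apply: map_f;
  by rewrite mem_iota /=; move: kL => /=; lia.
apply: le_trans (ler_sum_uniq _ us ut st) _; first by move=> k; exact: exprn_ge0.
have half : 0 <= (2^-1 : R) < 1 by apply/andP; split; lra.
have := sum_geometric_le L half.
rewrite big_cat !big_map /= [index_iota 0 L]/index_iota subn0 => h.
have -> : \sum_(i <- iota 0 L) (2^-1 : R) ^+ i.+1 = 2^-1 * \sum_(i <- iota 0 L) 2^-1 ^+ i.
  by rewrite mulr_sumr; apply: eq_bigr => i _; rewrite exprS.
have : (1 - (2^-1 : R))^-1 = 2 by field.
by move=> h2; rewrite h2 in h; lra.
Qed.

Lemma sum_halfX_int2 (s : seq (int * int)) : uniq s ->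
  \sum_(k <- s) ((2^-1 : R) ^+ `|k.1|%N * 2^-1 ^+ `|k.2|%N) <= 16.
Proof.
move=> us; pose s1 := undup [seq k.1 | k <- s]; pose s2 := undup [seq k.2 | k <- s].
have h0 : (0 : R) <= 2^-1 by rewrite invr_ge0.
apply: (@le_trans _ _ (\sum_(k <- [seq (x, y) | x <- s1, y <- s2])
    ((2^-1 : R) ^+ `|k.1|%N * 2^-1 ^+ `|k.2|%N))).
  apply: ler_sum_uniq => //.
  - by apply: allpairs_uniq; rewrite ?undup_uniq// => -[? ?] [? ?].
  - by move=> [a b] ks; apply/allpairsP; exists (a, b); rewrite !mem_undup; split => //;
    apply/mapP; exists (a, b).
rewrite big_allpairs /=.
under eq_bigr do rewrite -mulr_sumr.
rewrite -mulr_suml; have -> : 16 = 4 * 4 :> R by rewrite -natrM.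
by rewrite ler_pM ?sum_halfX_int ?undup_uniq ?sumr_ge0// => k _; rewrite exprn_ge0.
Qed.
End Tannery.

(** * Separation of variables in theta (x y) theta (x / y) *)

Section Wronskian.
Local Open Scope classical_set_scope.
Variable R : realType.
Local Notation K := (R[i]%C : numFieldType).
Local Notation N := (@Normc.normc R).

Lemma cvg_of_sub (u v : nat -> K) (l : K) :
  u @ \oo --> l -> (fun n => u n - v n) @ \oo --> (0 : K) -> v @ \oo --> l.
Proof.
move=> /cvgcP ul /cvgcP uv; apply/cvgcP => e e0.
have e2 : 0 < e / 2 by rewrite divr_gt0.
have ul2 := ul _ e2; have uv2 := uv _ e2; near=> n.
have h1 : N (l - u n) < e / 2 by near: n.
have h2 : N (0 - (u n - v n)) < e / 2 by near: n.
have -> : l - v n = (l - u n) - (0 - (u n - v n)) by ring.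
apply: le_lt_trans (le_normcD _ _) _; rewrite normcN; lra.
Unshelve. all: by end_near.
Qed.

Lemma cvg0_eq (u : nat -> K) (l : K) : u @ \oo --> l -> (forall n, u n = 0) -> l = 0.
Proof.
move=> /cvgcP ul u0; apply/eqP; rewrite -normc_neq0 eq_le normc_ge0 andbT leNgt.
by apply/negP => /ul [n _ /(_ n (leqnn n))]; rewrite /= u0 subr0 ltxx.
Qed.

(** The ratio of consecutive values of r^C(n, 2) (2 xi)^n is 2 xi r^n, eventually at most 1, so
    these values are bounded. *)
Lemma gauss_bound (r xi : R) : 0 <= r < 1 -> 0 <= xi ->
  exists M, forall n, r ^+ 'C(n, 2) * xi ^+ n <= M * 2^-1 ^+ n.
Proof.
move=> /andP[r0 r1] xi0.
have [M hM] : exists M, forall n, r ^+ 'C(n, 2) * (2 * xi) ^+ n <= M.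
  have : geometric (2 * xi) r @ \oo --> (0 : R) by apply: cvg_geometric; rewrite ger0_norm.
  move=> /cvgrPdist_lt /(_ 1 ltr01) [n0 _ hn0].
  apply: (@bounded_of_eventually _ _ (r ^+ 'C(n0, 2) * (2 * xi) ^+ n0)).
  exists n0 => // n /= /subnKC <-; elim: (n - n0)%N => [|k IH]; first by rewrite addn0.
  apply: le_trans IH; rewrite addnS binS bin1 exprD exprS.
  have := hn0 (n0 + k)%N (leq_addr _ _); rewrite /= sub0r normrN ger0_norm; last first.
    by rewrite mulr_ge0 ?mulr_ge0 ?exprn_ge0.
  set u := r ^+ 'C(_, 2); set v := r ^+ (n0 + k) => uv.
  have -> : u * v * (2 * xi * (2 * xi) ^+ (n0 + k)) =
      (u * (2 * xi) ^+ (n0 + k)) * (2 * xi * v) by ring.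
  by apply: ler_piMr; [rewrite !(mulr_ge0, exprn_ge0)|exact: ltW].
exists M => n; rewrite exprVn -ler_pdivrMr ?invr_gt0 ?exprn_gt0// invrK.
by apply: le_trans (hM n); rewrite exprMn; lra.
Qed.

Variable s : R[i].
Hypothesis s0 : s != 0.
Hypothesis s1 : N s < 1.
Let p := s ^+ 2.
Let p0 : p != 0. Proof. by rewrite expf_neq0. Qed.
Let p1 : `|p| < 1. Proof. exact: normc_sqr_lt1. Qed.

Lemma tterm_bound x : x != 0 ->
  exists2 M, 0 <= M & forall k, N (tterm s k x) <= M * 2^-1 ^+ `|k|%N.
Proof.
move=> x0; have p01 := normc_p_lt1 p1.
have [M1 h1] := gauss_bound p01 (normc_ge0 x).
(* For k = -n with n > 0, k (k - 1) / 2 = C(n, 2) + n; the additional p^n is absorbed by taking p /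
   x as the variable. *)
have [M2 h2] := @gauss_bound (N p) (N p / N x) p01 (divr_ge0 (normc_ge0 _) (normc_ge0 _)).
have M1_ge0 : 0 <= M1.
  by have := h1 0%N; rewrite !expr0 !mulr1; apply: le_trans; exact: ler01.
have M2_ge0 : 0 <= M2.
  by have := h2 0%N; rewrite !expr0 !mulr1; apply: le_trans; exact: ler01.
have sgn (k : int) : N ((-1) ^ k) = 1.
  have N1 n : N ((-1) ^+ n) = 1 by rewrite normcX normcN Normc.normc1 expr1n.
  by case: k => n; rewrite ?NegzE -?exprnP -?exprnN ?Normc.normcV N1 ?invr1.
exists (M1 + M2); first exact: addr_ge0.
move=> k; rewrite /tterm !Normc.normcM sgn mul1r.
have h0 n : (0 : R) <= 2^-1 ^+ n by rewrite exprn_ge0 ?invr_ge0.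
case: k => n.
  rewrite -(exprnP x n) -(expr_bin2 s0 s1 n) -/p (normcX p) (normcX x).
  by apply: le_trans (h1 n) _; rewrite ler_wpM2r ?lerDl//.
have -> : s ^ (Negz n * (Negz n - 1)) = p ^+ 'C(n.+1, 2) * p ^+ n.+1.
  have e : 'C(n.+2, 2) = ('C(n.+1, 2) + n.+1)%N by rewrite binS bin1.
  by rewrite -exprD -e (expr_bin2 s0 s1); congr (_ ^ _); lia.
rewrite NegzE -exprnN Normc.normcV Normc.normcM !(normcX p) (normcX x) abszN.
rewrite -mulrA -exprVn -exprMn.
by apply: le_trans (h2 n.+1) _; rewrite ler_wpM2r ?lerDr//.
Qed.

Definition zbox (m : nat) : seq int := [seq i%:Z - m%:Z | i <- index_iota 0 (m + m).+1].

Lemma mem_zbox m k : (k \in zbox m) = (`|k|%N <= m)%N.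
Proof.
apply/mapP/idP => [|km]; first by case=> i; rewrite mem_index_iota => /andP[_ im] ->; lia.
by exists (absz (k + m%:Z)%R); rewrite ?mem_index_iota; lia.
Qed.

Lemma zbox_uniq m : uniq (zbox m).
Proof. by rewrite map_inj_uniq ?iota_uniq// => i j; lia. Qed.

(** Zero off the box, where [absz] and the truncated subtraction in [gbin] lose their meaning; the
    coefficients are then bounded uniformly in [m] and [k]. *)
Definition zcoef (m : nat) (k : int) : R[i] :=
  if (`|k| <= m)%N then gbin s (m + m) (absz (k + m%:Z)%R) else 0.

Lemma theta_zbox x m : x != 0 ->
  qpoch p x m * qpoch p (p / x) m = \sum_(k <- zbox m) zcoef m k * tterm s k x.
Proof.
move=> x0; rewrite (theta_finite s0 s1)// big_map; apply: eq_big_nat => i /andP[_ im].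
rewrite /zcoef ifT; last by lia.
by congr (gbin _ _ _ * _); lia.
Qed.

Lemma qfact_inf_neq0 : qpoch_inf p p != 0.
Proof.
apply/eqP => /(qpoch_inf_eq0 p1) [j]; rewrite -exprSr => /eqP.
by rewrite (negPf (exprp_neq1 s1 j)).
Qed.

Lemma zcoef_bounded : exists B, forall m k, N (zcoef m k) <= B.
Proof.
have [B1 h1] := qpoch_bounded p1 p.
have [B2 h2] : exists B, forall n, N (qpoch p p n)^-1 <= B.
  by apply: (qpoch_inv_bounded p1) => j; rewrite -exprSr (exprp_neq1 s1).
have B1_ge0 : 0 <= B1 by apply: le_trans (h1 0%N); exact: normc_ge0.
have B2_ge0 : 0 <= B2 by apply: le_trans (h2 0%N); exact: normc_ge0.
exists (B1 * (B2 * B2)) => m k; rewrite /zcoef; case: ifP => _; last first.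
  by rewrite Normc.normc0 !mulr_ge0.
rewrite /gbin /qfact invfM !Normc.normcM ler_pM ?mulr_ge0 ?normc_ge0//.
by rewrite ler_pM ?normc_ge0.
Qed.

Lemma zcoef_cvg k : (fun m => zcoef m k : K) @ \oo --> ((qpoch_inf p p)^-1 : K).
Proof.
have Q := @qpoch_cvg R p p1 p.
have Qsub (phi : nat -> nat) : (forall n, \forall m \near \oo, (n <= phi m)%N) ->
    (fun m => qpoch p p (phi m) : K) @ \oo --> (qpoch_inf p p : K).
  move=> hphi; apply: (@cvg_comp _ _ _ phi (qpoch p p : nat -> K)) Q.
  by move=> A [n _ nA]; apply: filterS (hphi n) => m /= nm; apply: nA.
have lim1 : (fun m => qpoch p p (m + m) /
      (qpoch p p (absz (k + m%:Z)%R) * qpoch p p (m + m - absz (k + m%:Z)%R)%N) : K)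
    @ \oo --> (qpoch_inf p p / (qpoch_inf p p * qpoch_inf p p) : K).
  apply: cvgM; first by apply: Qsub => n; exists n => // m /= nm; lia.
  apply: cvgV; first by rewrite mulf_neq0// qfact_inf_neq0.
  apply: cvgM; apply: Qsub => n; exists (n + `|k|)%N => // m /= nm; lia.
have -> : (qpoch_inf p p)^-1 = qpoch_inf p p / (qpoch_inf p p * qpoch_inf p p).
  by rewrite invfM mulrA mulfV ?mul1r// qfact_inf_neq0.
apply: cvg_trans lim1; apply: near_eq_cvg; exists `|k|%N => // m /= km.
by rewrite /zcoef km.
Qed.

(** Truncations of Jacobi's theta_3 and, up to the factor p^(1/4), theta_2, of nome [p], in a
    multiplicative variable. *)
Definition theta_even (m : nat) (x : R[i]) := \sum_(b <- zbox m) s ^ (2 * b * b) * x ^ (2 * b).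
Definition theta_odd (m : nat) (x : R[i]) :=
  \sum_(b <- zbox m) s ^ (2 * b * (b + 1)) * x ^ (2 * b + 1).

Lemma mul_regroup (A : comPzRingType) (e1 e2 e f1 f2 f f' x1 x2 x x' y1 y2 y : A) :
  e1 * e2 = e -> f1 * f2 = f * f' -> x1 * x2 = x * x' -> y1 * y2 = y ->
  e1 * f1 * (x1 * y1) * (e2 * f2 * (x2 * y2)) = e * x * (f * x') * (f' * y).
Proof.
move=> <- ff xx <-; transitivity (e1 * e2 * (f1 * f2) * (x1 * x2) * (y1 * y2)); first by ring.
by rewrite ff xx; ring.
Qed.

(** The parallelogram law removes the mixed term: the exponents of [s] add up to 2 a (a + 1) + 2 b
    b. *)
Lemma tterm_mul_even (x y : R[i]) (a b : int) : x != 0 -> y != 0 ->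
  tterm s (a + b + 1) (x * y) * tterm s (a - b + 1) (x / y) =
  x * (s ^ (2 * a * (a + 1)) * x ^ (2 * a + 1)) * (s ^ (2 * b * b) * y ^ (2 * b)).
Proof.
move=> x0 y0; rewrite /tterm !expfzMl -expfV.
have sgn : (-1) ^ (a + b + 1) * (-1) ^ (a - b + 1) = 1 :> R[i].
  rewrite -expfzDr ?oppr_eq0 ?oner_eq0//.
  have -> : a + b + 1 + (a - b + 1) = 2 * (a + 1) by ring.
  by rewrite -exprz_exp -[2]/(Posz 2) -exprnP sqrrN expr1n exp1rz.
have sE : s ^ ((a + b + 1) * (a + b + 1 - 1)) * s ^ ((a - b + 1) * (a - b + 1 - 1)) =
    s ^ (2 * a * (a + 1)) * s ^ (2 * b * b).
  by rewrite -!expfzDr//; congr (_ ^ _); ring.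
have xE : x ^ (a + b + 1) * x ^ (a - b + 1) = x * x ^ (2 * a + 1).
  by rewrite -{3}(expr1z x) -!expfzDr//; congr (_ ^ _); ring.
have yE : y ^ (a + b + 1) / y ^ (a - b + 1) = y ^ (2 * b).
  by rewrite invr_expz -expfzDr//; congr (_ ^ _); ring.
by rewrite (mul_regroup sgn sE xE yE) mul1r.
Qed.

Lemma tterm_mul_odd (x y : R[i]) (a b : int) : x != 0 -> y != 0 ->
  tterm s (a + b + 1) (x * y) * tterm s (a - b) (x / y) =
  - x * (s ^ (2 * a * a) * x ^ (2 * a)) * (s ^ (2 * b * (b + 1)) * y ^ (2 * b + 1)).
Proof.
move=> x0 y0; rewrite /tterm !expfzMl -expfV.
have sgn : (-1) ^ (a + b + 1) * (-1) ^ (a - b) = -1 :> R[i].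
  rewrite -expfzDr ?oppr_eq0 ?oner_eq0//.
  have -> : a + b + 1 + (a - b) = 2 * a + 1 by ring.
  rewrite expfzDr ?oppr_eq0 ?oner_eq0// expr1z.
  by rewrite -exprz_exp -[2]/(Posz 2) -exprnP sqrrN expr1n exp1rz mul1r.
have sE : s ^ ((a + b + 1) * (a + b + 1 - 1)) * s ^ ((a - b) * (a - b - 1)) =
    s ^ (2 * a * a) * s ^ (2 * b * (b + 1)).
  by rewrite -!expfzDr//; congr (_ ^ _); ring.
have xE : x ^ (a + b + 1) * x ^ (a - b) = x * x ^ (2 * a).
  by rewrite -{3}(expr1z x) -!expfzDr//; congr (_ ^ _); ring.
have yE : y ^ (a + b + 1) / y ^ (a - b) = y ^ (2 * b + 1).
  by rewrite invr_expz -expfzDr//; congr (_ ^ _); ring.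
by rewrite (mul_regroup sgn sE xE yE) mulN1r.
Qed.

Let wron m x y := theta_odd m x * theta_even m y - theta_even m x * theta_odd m y.

(* The parametrization of the lattice by parity of [k - l]: the summation over it
   differs from the summation over a square box, but both exhaust the lattice. *)
Definition lattice_box m : seq (int * int) :=
  [seq (a + b + 1, a - b + 1) | a <- zbox m, b <- zbox m] ++
  [seq (a + b + 1, a - b) | a <- zbox m, b <- zbox m].

Lemma lattice_box_uniq m : uniq (lattice_box m).
Proof.
rewrite cat_uniq; apply/and3P; split.
- apply: allpairs_uniq; rewrite ?zbox_uniq// => -[a b] [c d] _ _ /= [e1 e2].
  by congr pair; lia.
- apply/hasPn => _ /allpairsP[[a b] [_ _ ->]]; apply/negP => /allpairsP[[c d] [_ _ []]] /=.
  lia.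
- apply: allpairs_uniq; rewrite ?zbox_uniq// => -[a b] [c d] _ _ /= [e1 e2].
  by congr pair; lia.
Qed.

Lemma lattice_box_near k : \forall m \near \oo, k \in lattice_box m.
Proof.
case: k => k l; exists (`|k|%N + `|l|%N).+1 => // m /= km; rewrite mem_cat.
have [h|h] : (exists c : int, k - l = 2 * c) \/ (exists c : int, k - l = 2 * c + 1).
  have : (k - l = 2 * ((k - l) %/ 2)%Z) \/ (k - l = 2 * ((k - l) %/ 2)%Z + 1) by lia.
  by case=> h; [left|right]; exists ((k - l) %/ 2)%Z.
- case: h => c kl; apply/orP; left; apply/allpairsP; exists (l + c - 1, c).
  by rewrite !mem_zbox /=; split; [lia|lia|congr pair; lia].
- case: h => c kl; apply/orP; right; apply/allpairsP; exists (l + c, c).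
  by rewrite !mem_zbox /=; split; [lia|lia|congr pair; lia].
Qed.

Lemma lattice_sum (x y : R[i]) m : x != 0 -> y != 0 ->
  \sum_(k <- lattice_box m) tterm s k.1 (x * y) * tterm s k.2 (x / y) = x * wron m x y.
Proof.
move=> x0 y0; rewrite big_cat !big_allpairs_dep /=.
under eq_bigr do under eq_bigr do rewrite tterm_mul_even//.
under [X in _ + X]eq_bigr do under eq_bigr do rewrite tterm_mul_odd//.
under eq_bigr do rewrite -mulr_sumr -(mulrA x).
under [X in _ + X]eq_bigr do rewrite -mulr_sumr -(mulrA (- x)).
by rewrite -!mulr_sumr -!mulr_suml mulNr -mulrBr.
Qed.

(** The partial products of the two thetas are sums over square boxes with coefficients [zcoef]; the
    determinant is a sum over [lattice_box] with the limiting coefficients. [tannery] shows that the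
    difference tends to 0, and the limit of the partial products is known by definition. *)
Lemma theta_wronskian (x y : R[i]) : x != 0 -> y != 0 ->
  (fun m => (qpoch_inf p p)^-1 ^+ 2 * (x * wron m x y) : K) @ \oo -->
  (theta (K := K) p (x * y) * theta (K := K) p (x / y) : K).
Proof.
move=> x0 y0; have xy0 : x * y != 0 by rewrite mulf_neq0.
have xVy0 : x / y != 0 by rewrite mulf_neq0 ?invr_eq0.
pose c := (qpoch_inf p p)^-1.
have [B hB] := zcoef_bounded.
have B0 : 0 <= B by apply: le_trans (hB 0%N 0); exact: normc_ge0.
have [M1 M10 h1] := tterm_bound xy0.
have [M2 M20 h2] := tterm_bound xVy0.
pose t (k : int * int) := tterm s k.1 (x * y) * tterm s k.2 (x / y).
pose h (k : int * int) := (2^-1 : R) ^+ `|k.1|%N * 2^-1 ^+ `|k.2|%N.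
have h0 k : 0 <= h k by rewrite mulr_ge0 ?exprn_ge0.
have th k : N (t k) <= M1 * M2 * h k.
  by rewrite /t Normc.normcM /h mulrACA; apply: ler_pM; rewrite ?normc_ge0 ?h1 ?h2.
(* [tannery] takes one dominating weight for both families: [B * B] serves [f] and [N (c ^+ 2)]
   serves [g]. *)
pose D := B * B + N (c ^+ 2).
have D0 : 0 <= D by rewrite addr_ge0 ?mulr_ge0 ?normc_ge0.
pose f m (k : int * int) := zcoef m k.1 * zcoef m k.2 * t k.
pose g (m : nat) (k : int * int) := c ^+ 2 * t k.
pose A m := [seq (k, l) | k <- zbox m, l <- zbox m].
have T : (fun m => \sum_(k <- A m) f m k - \sum_(k <- lattice_box m) g m k : K) @ \oo --> (0 : K).
  apply: (@tannery R _ (fun k => D * (M1 * M2 * h k)) (D * (M1 * M2 * 16))).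
  - move=> r ur; rewrite -mulr_sumr ler_wpM2l// -mulr_sumr ler_wpM2l ?mulr_ge0//.
    exact: sum_halfX_int2.
  - move=> m k; rewrite /f Normc.normcM ler_pM ?normc_ge0 ?th//.
    rewrite Normc.normcM (@le_trans _ _ (B * B)) ?ler_pM ?normc_ge0//.
    by rewrite lerDl normc_ge0.
  - move=> m k; rewrite /g Normc.normcM ler_pM ?normc_ge0 ?th//.
    by rewrite lerDr mulr_ge0.
  - move=> k; have := cvgB (cvgM (cvgM (@zcoef_cvg k.1) (@zcoef_cvg k.2))
        (@cvg_cst K (t k) nat \oo _)) (@cvg_cst K (c ^+ 2 * t k) nat \oo _).
    by rewrite -/c -expr2 subrr; apply.
  - by move=> m; apply: allpairs_uniq; rewrite ?zbox_uniq// => -[? ?] [? ?].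
  - exact: lattice_box_uniq.
  - move=> [k l]; exists (`|k|%N + `|l|%N)%N => // m /= km.
    by apply/allpairsP; exists (k, l); rewrite !mem_zbox; split => //=; apply: leq_trans km;
      [exact: leq_addr | exact: leq_addl].
  - exact: lattice_box_near.
have AE m : \sum_(k <- A m) f m k =
    (qpoch p (x * y) m * qpoch p (p / (x * y)) m) * (qpoch p (x / y) m * qpoch p (p / (x / y)) m).
  rewrite !theta_zbox// big_allpairs big_distrlr /=.
  by apply: eq_bigr => k _; apply: eq_bigr => l _; rewrite /f mulrACA.
have BE m : \sum_(k <- lattice_box m) g m k = c ^+ 2 * (x * wron m x y).
  by rewrite -mulr_sumr lattice_sum.
have AL : (fun m => \sum_(k <- A m) f m k : K) @ \oo -->
    (theta (K := K) p (x * y) * theta (K := K) p (x / y) : K).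
  under eq_fun do rewrite AE; rewrite !(theta_qpoch p1).
  by apply: cvgM; apply: cvgM; exact: qpoch_cvg.
have BL := cvg_of_sub AL T.
by apply: cvg_trans BL; apply: near_eq_cvg; apply: nearW => m; rewrite BE.
Qed.

(** All prefactors reduce to [k ^+ 2 * X], leaving the Plücker relation between the minors of a 2 x
    4 matrix. *)
Lemma plucker (F : fieldType) (k X r a b c o e oa ea ob eb oc ec : F) :
  r != 0 -> a != 0 -> b != 0 -> c != 0 ->
  k * (b / r * (ob * ec - eb * oc)) / b * (k * (X * r * (o * ea - e * oa))) +
  k * (c / r * (oc * ea - ec * oa)) / c * (k * (X * r * (o * eb - e * ob))) +
  k * (a / r * (oa * eb - ea * ob)) / a * (k * (X * r * (o * ec - e * oc))) = 0.
Proof. by move=> r0 a0 b0 c0; field; rewrite r0 a0 b0 c0. Qed.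

(** With r a square root of P, each product of two thetas has the form theta (x y) theta (x / y)
    with x, y among X r, a / r, b / r, c / r. The truncated combination is 0 for every [m], hence so
    is its limit. *)
Lemma theta3_sqr (P X a b c : R[i]) :
  P != 0 -> X != 0 -> a != 0 -> b != 0 -> c != 0 ->
  let th := theta (K := K) p in
  th (b * c / P) * th (b / c) / b * (th (a * X) * th (P * X / a)) +
  th (c * a / P) * th (c / a) / c * (th (b * X) * th (P * X / b)) +
  th (a * b / P) * th (a / b) / a * (th (c * X) * th (P * X / c)) = 0.
Proof.
move=> P0 X0 a0 b0 c0 th; pose r := sqrtC P.
have rP : P = r ^+ 2 by rewrite sqrtCK.
have r0 : r != 0 by apply: contraNneq P0 => r0; rewrite rP r0 expr0n.
pose k := (qpoch_inf p p)^-1 ^+ 2.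
have W1 u : u != 0 -> (fun m => k * (X * r * wron m (X * r) (u / r)) : K) @ \oo -->
    (th (u * X) * th (P * X / u) : K).
  move=> u0; have := @theta_wronskian (X * r) (u / r).
  rewrite !mulf_neq0 ?invr_eq0// => /(_ isT isT).
  have -> : X * r * (u / r) = u * X by field.
  by have -> : X * r / (u / r) = P * X / u by rewrite rP; field; rewrite u0 r0.
have W2 u v : u != 0 -> v != 0 -> (fun m => k * (u / r * wron m (u / r) (v / r)) / u : K) @ \oo -->
    (th (u * v / P) * th (u / v) / u : K).
  move=> u0 v0; have := @theta_wronskian (u / r) (v / r).
  rewrite !mulf_neq0 ?invr_eq0// => /(_ isT isT).
  have -> : u / r * (v / r) = u * v / P by rewrite rP; field.
  have -> : u / r / (v / r) = u / v by field; rewrite v0 r0.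
  by move=> /cvgM; apply; exact: cvg_cst.
have L := cvgD (cvgD (cvgM (W2 b c b0 c0) (W1 a a0)) (cvgM (W2 c a c0 a0) (W1 b b0)))
  (cvgM (W2 a b a0 b0) (W1 c c0)).
apply: (cvg0_eq (L _ _ _ _ _)) => m; exact: plucker.
Qed.
End Wronskian.

(** * Weierstrass's identity for every nome, and the summation *)

Lemma three_term_rational (F : fieldType) (P X a b c : F) :
  P != 0 -> X != 0 -> a != 0 -> b != 0 -> c != 0 ->
  (1 - b * c / P) * (1 - b / c) / b * ((1 - a * X) * (1 - P * X / a)) +
  (1 - c * a / P) * (1 - c / a) / c * ((1 - b * X) * (1 - P * X / b)) +
  (1 - a * b / P) * (1 - a / b) / a * ((1 - c * X) * (1 - P * X / c)) = 0.
Proof. by move=> P0 X0 a0 b0 c0; field; rewrite P0 a0 b0 c0. Qed.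

Lemma theta3 (R : realType) (p P X a b c : R[i]) : `|p| < 1 ->
  P != 0 -> X != 0 -> a != 0 -> b != 0 -> c != 0 ->
  let th := theta p in
  th (b * c / P) * th (b / c) / b * (th (a * X) * th (P * X / a)) +
  th (c * a / P) * th (c / a) / c * (th (b * X) * th (P * X / b)) +
  th (a * b / P) * th (a / b) / a * (th (c * X) * th (P * X / c)) = 0.
Proof.
(* The finite triple product divides by powers of [p], so p = 0 is checked as a rational
   identity. *)
move=> hp P0 X0 a0 b0 c0 th; have [p0|p0] := eqVneq p 0.
  by rewrite /th !theta_nome0//; exact: three_term_rational.
pose s := sqrtC p; have sp : s ^+ 2 = p by exact: sqrtCK.
have s0 : s != 0 by apply: contraNneq p0 => s0; rewrite -sp s0 expr0n.
have s1 : Normc.normc s < 1.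
  move: hp; rewrite -sp normrc ltcR normcX => h.
  by rewrite ltNge; apply/negP => ge1; move: h; rewrite ltNge exprn_ege1.
by rewrite /th -sp; exact: theta3_sqr.
Qed.

Theorem theorem5p1 (R : realType) (p q : R[i]) (n N : nat)
    (a : 'I_n.+1 -> R[i]) (b : R[i]) (z : 'I_n -> R[i])
    (hp : `|p| < 1) (hq : q != 0) (hn : (1 <= n)%N)
    (ha : forall j, a j != 0) (hb : b != 0) (hz : forall k, z k != 0)
    (hbal : b = (\prod_(j < n.+1) a j) * \prod_(k < n) z k)
    (* no denominator of either side vanishes *)
    (hVdm : evdm p z != 0)
    (hdenl : forall y : {ffun 'I_n -> 'I_N.+1},
      (\sum_(k < n) y k)%N = N -> forall k : 'I_n,
      epoch p q (b * z k) (y k) *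
        \prod_(j < n) epoch p q (q * z k / z j) (y k) != 0)
    (hdenr : epoch p q q N * \prod_(k < n) epoch p q (b * z k) N != 0) :
  \sum_(y : {ffun 'I_n -> 'I_N.+1} | (\sum_(k < n) y k)%N == N)
     (evdm p (qshift q z (fun k => y k)) / evdm p z *
      \prod_(k < n)
        ((\prod_(j < n.+1) epoch p q (a j * z k) (y k)) /
         (epoch p q (b * z k) (y k) *
          \prod_(j < n) epoch p q (q * z k / z j) (y k)))) =
  (\prod_(j < n.+1) epoch p q (b / a j) N) /
  (epoch p q q N * \prod_(k < n) epoch p q (b * z k) N).
Proof.
have epoch_neq0 x m : epoch p q x m != 0 -> forall i, (i < m)%N -> theta p (x * q ^+ i) != 0.
  by move=> /poch_neq0P.
have [hq0 /prodf_neq0 hbz] : epoch p q q N != 0 /\ \prod_(k < n) epoch p q (b * z k) N != 0.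
  by move: hdenr; rewrite mulf_eq0 negb_or => /andP[].
(* The denominator of the term y = N e_k contains the symbol of full length N. *)
have hqz k j : epoch p q (q * z k / z j) N != 0.
  have := hdenl [ffun i => if i == k then ord_max else ord0] _ k.
  rewrite ffunE eqxx mulf_eq0 negb_or => h.
  have /h /andP[_ /prodf_neq0/(_ j isT)//] :
      (\sum_(i < n) [ffun i => if i == k then ord_max else ord0 : 'I_N.+1] i)%N = N.
  rewrite (bigD1 k)//= ffunE eqxx big1 ?addn0// => i ik.
  by rewrite ffunE (negPf ik).
(* The Vandermonde product covers only j < k; the opposite order follows by inversion. *)
have hzz k j : j != k -> theta p (z k / z j) != 0.
  have lt_neq0 (i l : 'I_n) : (i < l)%N -> theta p (z l / z i) != 0.
    move=> il; move: hVdm => /prodf_neq0/(_ i isT)/prodf_neq0/(_ l il).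
    by rewrite mulf_eq0 negb_or => /andP[].
  move=> jk; case: (ltngtP j k) => [|kj|/val_inj jkE]; first exact: lt_neq0.
    rewrite -invf_div thetaV ?mulf_neq0 ?invr_eq0// oppr_eq0.
    by rewrite mulf_neq0 ?lt_neq0// invr_eq0 mulf_neq0 ?invr_eq0.
  by rewrite jkE eqxx in jk.
(* The bound [M] is taken to be [N]; [epoch], [evdm] and [qshift] are convertible to their abstract
   counterparts. *)
exact: (jackson_summation (theta1 hp) (thetaV hp)
  (fun P X a b c => @theta3 R p P X a b c hp) (theta_div_eq0 hp) hq ha hb hz hbal
  (fun k => epoch_neq0 _ _ (hbz k isT)) (fun k j => epoch_neq0 _ _ (hqz k j)) hzz (leqnn N) hVdm
  (epoch_neq0 _ _ hq0)).
Qed.
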